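(* With $q=0.288$, for any Borel set $E\subseteq[0,\frac12]$ and any $T$-cylinder $F$, $$\mu(T^{-n}E\cap F)=\mu(E)\mu(F)+O_F(q^n),$$ i.e. for every $T$-cylinder $F$ there is a constant $C_F>0$ depending only on $F$ such that $|\mu(T^{-n}E\cap F)-\mu(E)\mu(F)|\le C_F\,q^n$ for all integers $n\ge1$ and all Borel sets $E\subseteq[0,\frac12]$.
   Context: Let $G=\frac{\sqrt5+1}{2}$. The map $T:[0,\frac12]\to[0,\frac12]$ is defined by $T(0)=0$ and $T(x)=\left|\frac1x-\left\lfloor\frac1x+\frac12\right\rfloor\right|$ for $x\ne0$. The measure $\mu$ on $[0,\frac12]$ is the ($T$-invariant) probability measure $d\mu=\frac{1}{\log G}\left(\frac{1}{G+x}+\frac{1}{G+1-x}\right)dx$. $T^{-n}E$ denotes the preimage of $E$ under the $n$-th iterate of $T$. Let $W=\{(k,1):k\ge2\}\cup\{(k,-1):k\ge3\}$ ($k$ integer). The $T$-cylinders are the sets $\Delta_{[(a_1,e_1)]}=\left\{\frac{1}{a_1+e_1y}:y\in[0,\frac12]\right\}$ with $(a_1,e_1)\in W$, and, for $r\ge2$ and $(a_1,e_1),\dots,(a_r,e_r)\in W$, the sets $\Delta_{[(a_1,e_1),\dots,(a_r,e_r)]}=\bigcap_{i=1}^rT^{-(i-1)}\Delta_{[(a_i,e_i)]}$. *)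

(* Defs.v *)
From mathcomp Require Import all_boot all_order all_algebra.
From mathcomp Require Import all_classical all_reals all_analysis.

Set Implicit Arguments.
Unset Strict Implicit.
Unset Printing Implicit Defensive.

Import Order.TTheory GRing.Theory Num.Theory.
Import numFieldNormedType.Exports.

Local Open Scope classical_set_scope.
Local Open Scope ring_scope.

Section nearest_integer_continued_fraction.
Context (R : realType).

Definition golden : R := (Num.sqrt 5 + 1) / 2.

Definition half_interval : set R := `[0, 1 / 2]%classic.

(* Self-maps of [0, 1/2] and their preimages are represented on the whole of
   R: the formula below sends every real into [0, 1/2], and preimages are cut
   down to [0, 1/2] explicitly. *)
Definition nicf_map (x : R) : R :=
  if x == 0 then 0 else `| x^-1 - (Num.floor (x^-1 + 1 / 2))%:~R |.

Definition nicf_preimage (n : nat) (E : set R) : set R :=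
  half_interval `&` [set x | E (iter n nicf_map x)].

Definition nicf_density (x : R) : R :=
  (ln golden)^-1 * ((golden + x)^-1 + (golden + 1 - x)^-1).

Definition nicf_measure (A : set R) : \bar R :=
  (\int[lebesgue_measure]_(x in A `&` half_interval) (nicf_density x)%:E)%E.

Definition nicf_digit (d : int * int) : Prop :=
  (2 <= d.1 /\ d.2 = 1) \/ (3 <= d.1 /\ d.2 = -1).

Definition cylinder1 (d : int * int) : set R :=
  [set 1 / (d.1%:~R + d.2%:~R * y) | y in half_interval].

(* Positions are numbered from 0, so the i-th factor is a preimage under the
   i-th iterate; the default digit of [nth] is never reached. *)
Definition cylinder (w : seq (int * int)) : set R :=
  \bigcap_(i < size w) nicf_preimage i (cylinder1 (nth (0, 0) w i)).

Definition is_cylinder (F : set R) : Prop :=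
  exists w : seq (int * int),
    [/\ w <> [::], forall d, d \in w -> nicf_digit d & F = cylinder w].

End nearest_integer_continued_fraction.

(* Main.v *)
Require Import Defs.
From HB Require Import structures.
From mathcomp Require Import all_boot all_order all_algebra.
From mathcomp Require Import all_classical all_reals all_analysis.
From mathcomp Require Import measurable_realfun ring lra.
Import Order.TTheory GRing.Theory Num.Theory.
Import numFieldNormedType.Exports.

(* Every branch of the map [T] is onto [0, 1/2], so a measure [g dmu] with
   Lipschitz density [g] is carried by [T] to [(U g) dmu], where [U] is the
   transfer operator normalised so that [U 1 = 1]. With [G] the golden ratio and
   [eps = sqrt 5 - 2], the density of [mu] is proportional to
   [1 / (1 + eps x (1 - x))] on [0, 1], and
     [U g x = sum_(k >= 2) (b_k g x + b_k g (1 - x))],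
     [b_k g z = (1 + eps z (1 - z)) / Q (k + z) * g (1 / (k + z))],
     [Q b = b ^ 2 + eps (b - 1) = (b + G - 2) (b + G - 1)].
   Subtracting the constant [g (1 / 3)] and bounding the Lipschitz constant of
   each [b_k] separately shows that [U] contracts Lipschitz constants by a factor
   at most 0.288. A cylinder [F] of rank [r] satisfies
   [mu (T^-(r+m) E :&: F) = mu-integral over E of U^m g_F] with [g_F] Lipschitz,
   and the oscillation of [U^m g_F] is O(0.288 ^ m). *)

Set Implicit Arguments.
Unset Strict Implicit.
Unset Printing Implicit Defensive.

Local Open Scope classical_set_scope.
Local Open Scope ring_scope.

(** * Lipschitz estimates for the inverse branches *)

Section contraction.
Context (R : rcfType).
Implicit Types (g : R -> R) (x y z k M : R).

(* [2 G - 3], where [G] is the golden ratio. *)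
Definition eps : R := Num.sqrt 5 - 2.

Lemma eps_sq : eps ^+ 2 = 1 - 4 * eps.
Proof.
have h : (Num.sqrt 5 : R) ^+ 2 = 5 by rewrite sqr_sqrtr.
by move: h; rewrite /eps; set s := Num.sqrt _ => h; rewrite sqrrB h; ring.
Qed.

Lemma eps_bounds : 4 / 17 <= eps <= 17 / 72.
Proof.
have h : (Num.sqrt 5 : R) ^+ 2 = 5 by rewrite sqr_sqrtr.
have h0 : 0 <= (Num.sqrt 5 : R) by exact: sqrtr_ge0.
by move: h h0; rewrite /eps; set s := Num.sqrt _ => h h0; apply/andP; split; nra.
Qed.

(** For [b != 0] this is [b ^+ 2 * weight b^-1]: the weight at the image point [b^-1] combined with
    the Jacobian of inversion. *)
Definition quad (b : R) : R := b ^+ 2 + eps * (b - 1).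

Lemma quad_ge (b c : R) : 1 <= c -> c <= b -> c ^+ 2 + 4 / 17 * (c - 1) <= quad b.
Proof. by move: eps_bounds => /andP[e1 e2] c1 cb; rewrite /quad; nra. Qed.

Lemma quad_gt0 (b : R) : 1 <= b -> 0 < quad b.
Proof. by move=> b1; have := quad_ge b1 (lexx _); nra. Qed.

(* The invariant density is [(ln G)^-1 / weight] on [[0, 1/2]]. *)
Definition weight (z : R) : R := 1 + eps * (z * (1 - z)).

Lemma weight_bounds (z : R) : 0 <= z <= 1 -> 1 <= weight z <= 53 / 50.
Proof.
move: eps_bounds => /andP[e1 e2] /andP[z0 z1]; rewrite /weight.
have zz : 0 <= z * (1 - z) by nra.
have zz' : z * (1 - z) <= 1 / 4 by have := sqr_ge0 (z - 1 / 2); nra.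
by move: (z * (1 - z)) zz zz' => q q0 q1; apply/andP; split; nra.
Qed.

(* The digit [(k, 1)] contributes [branch k g x] to the transfer operator, and the digit
   [(k + 1, -1)] contributes [branch k g (1 - x)]. *)
Definition branch (k : R) g z : R := weight z / quad (k + z) * g (k + z)^-1.

Definition lip (M : R) g := forall x y, 0 <= x <= 1 / 2 -> 0 <= y <= 1 / 2 ->
  `|g x - g y| <= M * `|x - y|.

(* Bounds the Lipschitz constant of [branch k g] where [b <= k + z] and [|g| <= d], for [g]
   1-Lipschitz; 53/50 bounds [weight], and 4/17 and 17/72 are convergents enclosing [eps]. *)
Definition kappa (b d : R) : R :=
  let s := b ^+ 2 + 4 / 17 * (b - 1) in
  53 / 50 / (s * b ^+ 2) + (53 / 50 * (2 * b + 17 / 72) / s ^+ 2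
     + 17 / 72 / s) * d.

Lemma weight_lip (z1 z2 : R) : 0 <= z1 <= 1 -> 0 <= z2 <= 1 ->
  `|weight z1 - weight z2| <= 17 / 72 * `|z1 - z2|.
Proof.
move: eps_bounds => /andP[e1 e2] /andP[z0 z1'] /andP[y0 y1].
rewrite (_ : _ - _ = eps * (1 - z1 - z2) * (z1 - z2)); last by rewrite /weight; ring.
rewrite normrM ler_wpM2r//.
by rewrite ler_norml; apply/andP; split; nra.
Qed.

Lemma inv_half (b : R) : 2 <= b -> 0 <= b^-1 <= 1 / 2.
Proof.
move=> b2; have b0 : 0 < b by lra.
by rewrite invr_ge0 ltW //= mul1r lef_pV2 // ?posrE //; lra.
Qed.

(** The difference quotient has absolute value [(b1 + b2 + eps) / (quad b1 * quad b2)], an average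
    of two products of [(2 b + eps) / quad b] with [1 / quad b]. All these factors decrease in [b],
    so [c] is the worst case, and there rational bounds replace [eps]. *)
Lemma quad_inv_lip (c b1 b2 : R) : 2 <= c -> c <= b1 -> c <= b2 ->
  `|(quad b1)^-1 - (quad b2)^-1| <=
  (2 * c + 17 / 72) / (c ^+ 2 + 4 / 17 * (c - 1)) ^+ 2 * `|b1 - b2|.
Proof.
move=> c2 cb1 cb2; move: eps_bounds => /andP[e1 e2].
have S1 : 0 < quad b1 by apply: quad_gt0; lra.
have S2 : 0 < quad b2 by apply: quad_gt0; lra.
rewrite (_ : _ - _ = - ((b1 + b2 + eps) / (quad b1 * quad b2) * (b1 - b2))); last first.
  have n1 : quad b1 != 0 by rewrite gt_eqF.
  have n2 : quad b2 != 0 by rewrite gt_eqF.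
  rewrite (_ : _ - _ = (quad b2 - quad b1) / (quad b1 * quad b2)); last by field; apply/andP.
  by rewrite (_ : quad b2 - quad b1 = - ((b1 + b2 + eps) * (b1 - b2))); [field; apply/andP | rewrite /quad; ring].
rewrite normrN normrM ler_wpM2r// ger0_norm; last first.
  by rewrite divr_ge0 ?mulr_ge0 ?ltW//; lra.
set s := c ^+ 2 + _.
have s0 : 0 < s by rewrite /s; nra.
(* [b |-> (2b + eps) / quad b] is decreasing *)
have key b : c <= b -> (2 * b + eps) / quad b <= (2 * c + 17 / 72) / s.
  move=> cb; have Sb : 0 < quad b by apply: quad_gt0; lra.
  have Sc : 0 < quad c by apply: quad_gt0; lra.
  apply: (@le_trans _ _ ((2 * c + eps) / quad c)).
    rewrite ler_pdivrMr // mulrAC ler_pdivlMr // -subr_ge0.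
    rewrite (_ : _ - _ = (b - c) * (2 * (b * c) + 2 * eps + eps * (b + c) + eps ^+ 2)); last first.
      by rewrite /quad; ring.
    have c0 : 0 <= c by lra.
    have b0 : 0 <= b by lra.
    have ee : 0 <= eps by lra.
    have bc : 0 <= b * c by exact: mulr_ge0.
    have ebc : 0 <= eps * (b + c) by apply: mulr_ge0; lra.
    have e2' := sqr_ge0 eps.
    by apply: mulr_ge0; lra.
  by apply: ler_pM; rewrite ?invr_ge0 ?(ltW Sc) ?lef_pV2 ?posrE ?quad_ge //; lra.
have inv_le b : c <= b -> (quad b)^-1 <= s^-1.
  by move=> cb; rewrite lef_pV2 ?posrE ?quad_ge//; [|apply: quad_gt0]; lra.
have -> : (b1 + b2 + eps) / (quad b1 * quad b2) =
  ((2 * b1 + eps) / quad b1 * (quad b2)^-1 + (2 * b2 + eps) / quad b2 * (quad b1)^-1) / 2.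
  by field; rewrite !gt_eqF.
have -> : (2 * c + 17 / 72) / s ^+ 2 =
  ((2 * c + 17 / 72) / s * s^-1 + (2 * c + 17 / 72) / s * s^-1) / 2.
  by field; rewrite !gt_eqF.
have pos b : c <= b -> 0 <= (2 * b + eps) / quad b.
  by move=> cb; rewrite divr_ge0 ?ltW ?quad_gt0 //; lra.
have Vpos b : c <= b -> 0 <= (quad b)^-1.
  by move=> cb; rewrite invr_ge0 ltW // quad_gt0 //; lra.
by apply: ler_wpM2r; rewrite ?invr_ge0 //; apply: lerD; apply: ler_pM; auto.
Qed.


(** A discrete product rule over the factors [weight], [1 / quad] and [g]. The size of [g] is
    measured by [d] in units of [M], which makes the whole bound proportional to [M]. *)
Lemma branch_lip (M k b d : R) g z1 z2 : 2 <= b -> 0 <= M -> lip M g ->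
  0 <= z1 <= 1 -> 0 <= z2 <= 1 -> b <= k + z1 -> b <= k + z2 ->
  `|g (k + z2)^-1| <= M * d ->
  `|branch k g z1 - branch k g z2| <= kappa b d * (M * `|z1 - z2|).
Proof.
move=> b2 M0 gM z1I z2I bz1 bz2 gd.
have ge2 z : b <= k + z -> 2 <= k + z by move=> ?; lra.
have [n1 n1'] := andP (weight_bounds z1I).
have [n2 n2'] := andP (weight_bounds z2I).
have S1 : 0 < quad (k + z1) by apply: quad_gt0; lra.
have S2 : 0 < quad (k + z2) by apply: quad_gt0; lra.
have b0 : 0 < b by lra.
rewrite /kappa /=; set s := b ^+ 2 + _.
have s0 : 0 < s by rewrite /s; nra.
have inv_le z : b <= k + z -> (quad (k + z))^-1 <= s^-1.
  by move=> bz; rewrite lef_pV2 ?posrE ?quad_ge//; [|apply: quad_gt0]; lra.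
have uu : `|(k + z1)^-1 - (k + z2)^-1| <= (b ^+ 2)^-1 * `|z1 - z2|.
  have k1 : 0 < k + z1 by lra.
  have k2 : 0 < k + z2 by lra.
  rewrite (_ : _ - _ = - ((k + z1)^-1 * (k + z2)^-1 * (z1 - z2))); last first.
    by field; rewrite !gt_eqF.
  have i1 : 0 <= (k + z1)^-1 by rewrite invr_ge0 ltW.
  have i2 : 0 <= (k + z2)^-1 by rewrite invr_ge0 ltW.
  rewrite normrN normrM (ger0_norm (mulr_ge0 i1 i2)) ler_wpM2r // expr2 invfM.
  by rewrite ler_pM ?lef_pV2 ?posrE.
set D := `|z1 - z2|.
have D0 : 0 <= D by exact: normr_ge0.
(* Vary [g] with its coefficient frozen at [z1], then vary the coefficient with [g] frozen at [z2],
   where [M * d] bounds it. *)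
rewrite (_ : branch k g z1 - branch k g z2 =
  weight z1 / quad (k + z1) * (g (k + z1)^-1 - g (k + z2)^-1) +
  (weight z1 * ((quad (k + z1))^-1 - (quad (k + z2))^-1) +
   (weight z1 - weight z2) / quad (k + z2)) * g (k + z2)^-1); last first.
  by rewrite /branch; ring.
have -> : (53 / 50 / (s * b ^+ 2) + (53 / 50 * (2 * b + 17 / 72) / s ^+ 2 + 17 / 72 / s) * d) *
   (M * D) = (53 / 50 / s) * (M * ((b ^+ 2)^-1 * D)) +
   ((53 / 50) * ((2 * b + 17 / 72) / s ^+ 2 * D) + (17 / 72 * D) / s) * (M * d).
  by field; rewrite !gt_eqF.
apply: (le_trans (ler_normD _ _)); apply: lerD.
  rewrite normrM ler_pM ?normr_ge0 //.
    rewrite ger0_norm; last by rewrite divr_ge0 // ltW//; lra.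
    by rewrite ler_pM ?invr_ge0 ?inv_le ?(ltW S1) //; lra.
  apply: (le_trans (gM _ _ _ _)); rewrite ?inv_half ?ge2 //.
  by rewrite ler_wpM2l.
rewrite normrM ler_pM ?normr_ge0 //.
apply: (le_trans (ler_normD _ _)); apply: lerD; rewrite normrM.
  rewrite ler_pM ?normr_ge0 //; first by rewrite ger0_norm; lra.
  rewrite (_ : z1 - z2 = (k + z1) - (k + z2)) in @D D0 *; last by ring.
  exact: quad_inv_lip.
rewrite ler_pM ?normr_ge0 ?weight_lip //.
by rewrite ger0_norm ?invr_ge0 ?(ltW S2) // inv_le.
Qed.

(** In the pair [k = 2] the arguments of [g] fill [[2/5, 1/2]] and [[1/3, 2/5]]; their largest
    distances from [1/3] are [1/6] and [1/15]. *)
Lemma kappa_first : kappa 2 (1 / 6) + kappa (5 / 2) (1 / 15) <= 2 / 13.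
Proof.
have h1 : kappa 2 (1 / 6) = 53 / 50 * (17 / 288) + (53 / 50 * (305 / 72) + 1) * (17 / 72) ^+ 2 / 6.
  by rewrite /kappa /=; field.
have h2 : kappa (5 / 2) (1 / 15) = 53 / 50 * (68 / 449) * (4 / 25) +
    (53 / 50 * (377 / 72) * (68 / 449) + 17 / 72) * (68 / 449) / 15.
  by rewrite /kappa /=; field.
have a1 : kappa 2 (1 / 6) <= 23 / 200.
  by rewrite h1; lra.
have a2 : kappa (5 / 2) (1 / 15) <= 37 / 1000.
  by rewrite h2; lra.
lra.
Qed.

(** Both branches of the pair [k] evaluate [g] in [[1/(k+1), 1/k]], at distance at most
    [1/3 - 1/(k+1)] from [1/3]; hence the factor 2. The right side is a telescoping term of the same
    order [1 / k ^ 2] as the left. *)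
Lemma kappa_tail (k : R) : 3 <= k ->
  2 * kappa k (1 / 3 - (k + 1)^-1) <= 1 / 5 / (k - 3 / 2) - 1 / 5 / (k - 1 / 2).
Proof.
move=> k3; rewrite /kappa /=; set s := k ^+ 2 + _; set d := 1 / 3 - _.
have k0 : 0 < k by lra.
have kk0 : 0 < k ^+ 2 by rewrite exprn_gt0.
have s0 : k ^+ 2 <= s by rewrite /s; lra.
have dE : d = (k - 2) / (3 * (k + 1)) by rewrite /d; field; rewrite gt_eqF //; lra.
have d0 : 0 <= d by rewrite dE divr_ge0 //; lra.
have si : s^-1 <= (k ^+ 2)^-1 by rewrite lef_pV2 ?posrE //; lra.
have si0 : 0 <= s^-1 by rewrite invr_ge0; lra.
have ki0 : 0 < (k ^+ 2)^-1 by rewrite invr_gt0.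
have b1 : 2 * (53 / 50 / (s * k ^+ 2)) <= 17 / 8 * ((k ^+ 2)^-1 * (k ^+ 2)^-1).
  rewrite invfM; have := ler_wpM2r (ltW ki0) si.
  have : 0 <= s^-1 / k ^+ 2 by rewrite mulr_ge0 // ltW.
  by lra.
(* The slack [k / 100] in the linear coefficient pays for rounding [53 / 50 * (17 / 36)] down to
   [1 / 2]. *)
have b2 : 2 * (53 / 50 * (2 * k + 17 / 72) / s ^+ 2 + 17 / 72 / s) <=
    (17 / 4 * k + 1 / 2) * ((k ^+ 2)^-1 * (k ^+ 2)^-1) + 17 / 36 * (k ^+ 2)^-1.
  have ss : s^-1 ^+ 2 <= (k ^+ 2)^-1 * (k ^+ 2)^-1 by rewrite expr2 ler_pM.
  rewrite -exprVn mulrDr lerD //; last lra.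
  rewrite mulrA ler_pM ?sqr_ge0 //; lra.
apply: (@le_trans _ _ (17 / 8 * ((k ^+ 2)^-1 * (k ^+ 2)^-1) +
   ((17 / 4 * k + 1 / 2) * ((k ^+ 2)^-1 * (k ^+ 2)^-1) + 17 / 36 * (k ^+ 2)^-1) * d)).
  by rewrite [leLHS]mulrDr lerD // [leLHS]mulrA ler_wpM2r.
have [t t0 kE] : exists2 t, 0 <= t & k = 3 + t by exists (k - 3); lra.
have -> : 17 / 8 * ((k ^+ 2)^-1 * (k ^+ 2)^-1) +
   ((17 / 4 * k + 1 / 2) * ((k ^+ 2)^-1 * (k ^+ 2)^-1) + 17 / 36 * (k ^+ 2)^-1) * d =
   (459 * (k + 1) + (34 * k ^+ 2 + 306 * k + 36) * (k - 2)) / (216 * k ^+ 4 * (k + 1)).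
  by rewrite dE; field; rewrite ?gt_eqF //; lra.
have -> : 1 / 5 / (k - 3 / 2) - 1 / 5 / (k - 1 / 2) = 4 / (5 * (2 * k - 3) * (2 * k - 1)).
  by field; rewrite ?gt_eqF //; lra.
rewrite ler_pdivrMr; last by rewrite !mulr_gt0 ?exprn_gt0 //; lra.
rewrite mulrAC ler_pdivlMr; last by rewrite !mulr_gt0 //; lra.
(* With denominators cleared, the difference is a polynomial in [t = k - 3 >= 0]; the two squares
   absorb its negative coefficients. *)
rewrite -subr_ge0 kE (_ : _ - _ = t * (13 * t ^+ 2 - 168) ^+ 2 + 15 * t ^+ 5 +
   153 * t + 1846 * t ^+ 3 +
   (14 * t ^+ 2 - 200) ^+ 2 + 28 * t ^+ 4 + 4496 * t ^+ 2 + 7736); last by ring.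
have p0 := mulr_ge0 t0 (sqr_ge0 (13 * t ^+ 2 - 168)).
have p1 := sqr_ge0 (14 * t ^+ 2 - 200).
have p n := exprn_ge0 n t0.
move: (t * _) ((14 * _ - _) ^+ 2) p0 p1 (p 2) (p 3) (p 4) (p 5) => u v u0 v0.
by move: (t ^+ 2) (t ^+ 3) (t ^+ 4) (t ^+ 5) => t2 t3 t4 t5 *; lra.
Qed.


Definition branch_pair (k : R) g x : R := branch k g x + branch k g (1 - x).

(** The point [1/3] separates the arguments of the first pair, in [[1/3, 1/2]], from those of all
    later pairs, in []0, 1/3]]. Normalising [g] to vanish there keeps it small on both sides. *)
Lemma inv_third (M c : R) g : 0 <= M -> lip M g -> g (1 / 3) = 0 -> 2 <= c ->
  `|g c^-1| <= M * `|c^-1 - 1 / 3|.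
Proof.
move=> M0 gM g0 c2; have := gM c^-1 (1 / 3); rewrite g0 subr0; apply.
  exact: inv_half.
lra.
Qed.

Lemma branch_pair_lip_first (M : R) g x y : 0 <= M -> lip M g -> g (1 / 3) = 0 ->
  0 <= x <= 1 / 2 -> 0 <= y <= 1 / 2 ->
  `|branch_pair 2 g x - branch_pair 2 g y| <= 2 / 13 * (M * `|x - y|).
Proof.
move=> M0 gM g0 xI yI; move: (xI) (yI) => /andP[x0 x1] /andP[y0 y1].
have inv_le (c d : R) : 0 < c -> c <= d -> d^-1 <= c^-1.
  by move=> c0 cd; rewrite lef_pV2 ?posrE //; lra.
have bnd (c c1 c2 d : R) : 2 <= c1 -> c1 <= c -> c <= c2 -> c1^-1 - 1 / 3 <= d ->
    1 / 3 - c2^-1 <= d -> `|g c^-1| <= M * d.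
  move=> h1 h2 h3 h4 h5; apply: (le_trans (inv_third M0 gM g0 _)); first lra.
  rewrite ler_wpM2l // ler_norml.
  have a1 := inv_le c1 c; have a2 := inv_le c c2.
  by apply/andP; split; [have := a2 ltac:(lra) h3 | have := a1 ltac:(lra) h2]; lra.
rewrite (_ : _ - _ = (branch 2 g x - branch 2 g y) + (branch 2 g (1 - x) - branch 2 g (1 - y)));
  last by rewrite /branch_pair; ring.
apply: (le_trans (ler_normD _ _)).
have b1 : `|branch 2 g x - branch 2 g y| <= kappa 2 (1 / 6) * (M * `|x - y|).
  apply: branch_lip => //; try lra.
  by apply: (bnd _ 2 (5 / 2)); lra.
have b2 : `|branch 2 g (1 - x) - branch 2 g (1 - y)| <= kappa (5 / 2) (1 / 15) * (M * `|x - y|).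
  rewrite (_ : `|x - y| = `|(1 - x) - (1 - y)|); last by rewrite -normrN; congr `| _ |; ring.
  apply: branch_lip => //; try lra.
  by apply: (bnd _ (5 / 2) 3); lra.
have MD : 0 <= M * `|x - y| by rewrite mulr_ge0.
by apply: (le_trans (lerD b1 b2)); rewrite -mulrDl ler_wpM2r // kappa_first.
Qed.

Lemma branch_pair_lip_tail (M k : R) g x y : 3 <= k -> 0 <= M -> lip M g -> g (1 / 3) = 0 ->
  0 <= x <= 1 / 2 -> 0 <= y <= 1 / 2 ->
  `|branch_pair k g x - branch_pair k g y| <=
  (1 / 5 / (k - 3 / 2) - 1 / 5 / (k - 1 / 2)) * (M * `|x - y|).
Proof.
move=> k3 M0 gM g0 xI yI; move: (xI) (yI) => /andP[x0 x1] /andP[y0 y1].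
have bnd z : 0 <= z <= 1 -> `|g (k + z)^-1| <= M * (1 / 3 - (k + 1)^-1).
  move=> /andP[z0 z1]; apply: (le_trans (inv_third M0 gM g0 _)); first lra.
  have a1 : (k + z)^-1 <= 3^-1 by rewrite lef_pV2 ?posrE //; lra.
  have a2 : (k + 1)^-1 <= (k + z)^-1 by rewrite lef_pV2 ?posrE //; lra.
  by rewrite ler_wpM2l // ler0_norm; lra.
rewrite (_ : _ - _ = (branch k g x - branch k g y) + (branch k g (1 - x) - branch k g (1 - y)));
  last by rewrite /branch_pair; ring.
apply: (le_trans (ler_normD _ _)).
have b1 : `|branch k g x - branch k g y| <= kappa k (1 / 3 - (k + 1)^-1) * (M * `|x - y|).
  by apply: branch_lip => //; try lra; apply: bnd; lra.
have b2 : `|branch k g (1 - x) - branch k g (1 - y)| <=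
    kappa k (1 / 3 - (k + 1)^-1) * (M * `|x - y|).
  rewrite (_ : `|x - y| = `|(1 - x) - (1 - y)|); last by rewrite -normrN; congr `| _ |; ring.
  by apply: branch_lip => //; try lra; apply: bnd; lra.
have MD : 0 <= M * `|x - y| by rewrite mulr_ge0.
apply: (le_trans (lerD b1 b2)); rewrite -mulrDl ler_wpM2r //.
have := kappa_tail k3; lra.
Qed.

(* [2 / 13 + 1 / 5 / (3 - 3 / 2) < 0.288], the second summand being the telescoped tail. *)
Lemma sum_branch_pair_lip (M : R) g x y N : 0 <= M -> lip M g -> g (1 / 3) = 0 ->
  0 <= x <= 1 / 2 -> 0 <= y <= 1 / 2 ->
  `|\sum_(0 <= j < N) branch_pair (j.+2)%:R g x - \sum_(0 <= j < N) branch_pair (j.+2)%:R g y|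
  <= 288 / 1000 * (M * `|x - y|).
Proof.
move=> M0 gM g0 xI yI; rewrite -sumrB.
have MD : 0 <= M * `|x - y| by rewrite mulr_ge0.
apply: (@le_trans _ _ ((2 / 13 + 2 / 15) * (M * `|x - y|))); last first.
  by rewrite ler_wpM2r //; lra.
case: N => [|N]; first by rewrite big_geq // normr0; apply: mulr_ge0 => //; lra.
rewrite big_nat_recl // mulrDl; apply: (le_trans (ler_normD _ _)); apply: lerD.
  exact: branch_pair_lip_first.
apply: (le_trans (ler_norm_sum _ _ _)).
(* The tail starts at [k = j + 3], so [k - 3 / 2] is [j + 3 / 2] and [k - 1 / 2] is the same
   expression at [j + 1]. *)
apply: (@le_trans _ _ (\sum_(0 <= j < N) (1 / 5 / (j%:R + 3 / 2) - 1 / 5 / (j.+1%:R + 3 / 2)) * (M * `|x - y|))).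
  apply: ler_sum => j _.
  have k3 : 3 <= (j.+3)%:R :> R by rewrite ler_nat.
  apply: (le_trans (branch_pair_lip_tail k3 M0 gM g0 xI yI)).
  rewrite ler_wpM2r // le_eqVlt; apply/orP; left; apply/eqP.
  have e3 : j.+3%:R = j%:R + 3 :> R by rewrite -addn3 natrD.
  by rewrite e3 -(natr1 j); congr (_ / _ - _ / _); field.
rewrite -mulr_suml ler_wpM2r // (_ : \sum_(0 <= _ < N) _ = 2 / 15 - 1 / 5 / (N%:R + 3 / 2)).
  have N0 : 0 <= N%:R :> R by [].
  by have : 0 <= 1 / 5 / (N%:R + 3 / 2) :> R; [apply: divr_ge0 | ]; lra.
elim: N => [|N IH]; first by rewrite big_geq //; field.
by rewrite big_nat_recr //= IH; ring.
Qed.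

End contraction.

(** * The normalised transfer operator *)

Section transfer.
Context (R : realType).
Implicit Types (g : R -> R) (x y z k M : R).

Lemma goldenE : golden R = (eps R + 3) / 2.
Proof. by rewrite /golden /eps; field. Qed.

Lemma golden_sq : golden R ^+ 2 = golden R + 1.
Proof.
rewrite goldenE; have := eps_sq R; move: (eps R) => e he.
by rewrite (_ : ((e + 3) / 2) ^+ 2 = (e ^+ 2 + 6 * e + 9) / 4); [rewrite he; field | field].
Qed.

Lemma golden_bounds : 8 / 5 <= golden R <= 13 / 8.
Proof.
by rewrite goldenE; have /andP[] := eps_bounds R; move: (eps R) => e *; apply/andP; split; lra.
Qed.

(** The two sides differ by a multiple of [G ^ 2 - G - 1]. *)
Lemma weightE z : weight z * (golden R + golden R + 1) =
  (golden R + z) * (golden R + 1 - z).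
Proof.
have e : eps R = 2 * golden R - 3 by rewrite goldenE; field.
have := golden_sq; rewrite /weight e; move: (golden R) => G G2.
apply/eqP; rewrite -subr_eq0; apply/eqP.
by rewrite [LHS](_ : _ = (4 * z * (1 - z) - 1) * (G ^+ 2 - G - 1)); [rewrite G2 | ]; ring.
Qed.

Lemma density_weight z : 0 <= z <= 1 ->
  (golden R + z)^-1 + (golden R + 1 - z)^-1 = (weight z)^-1.
Proof.
move=> zI; have /andP[w1 _] := weight_bounds zI; move: zI => /andP[z0 z1].
have /andP[G1 _] := golden_bounds; have := weightE z.
move: (weight z) w1 (golden R) G1 => w w1 G G1 e.
apply: (@mulIf _ w); first by rewrite gt_eqF //; lra.
rewrite mulVf ?gt_eqF //; last lra.
have n1 : G + z != 0 by rewrite gt_eqF //; lra.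
have n2 : G + 1 - z != 0 by rewrite gt_eqF //; lra.
have -> : (G + z)^-1 + (G + 1 - z)^-1 = (G + G + 1) / ((G + z) * (G + 1 - z)).
  by field; apply/andP.
by rewrite mulrAC [X in X / _]mulrC e divff // mulf_neq0.
Qed.

Lemma quadE (b : R) : quad b = (b + golden R - 2) * (b + golden R - 1).
Proof.
rewrite goldenE /quad; have := eps_sq R; move: (eps R) => e he.
by rewrite [RHS](_ : _ = b ^+ 2 + e * b - b + b + (e ^+ 2 - 1) / 4); [rewrite he; field | field].
Qed.

(** The roots of [quad] differ by 1, so these partial fractions telescope along [b, b + 1, ...]. *)
Lemma quadV (b : R) : 1 <= b -> (quad b)^-1 = (b + golden R - 2)^-1 - (b + golden R - 1)^-1.
Proof.
move=> b1; have /andP[G1 _] := golden_bounds; rewrite quadE.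
by field; apply/andP; split; rewrite gt_eqF //; lra.
Qed.

(** Finite form of [U 1 = 1]. The symmetry of [weight] under [z |-> 1 - z] pulls it out of both
    telescoping sums, whose initial terms add up to [1 / weight x] by [density_weight]. *)
Lemma sum_branch_pair1 x N : 0 <= x <= 1 / 2 ->
  \sum_(0 <= j < N) branch_pair j.+2%:R (cst 1) x =
  1 - weight x * ((golden R + x + N%:R)^-1 + (golden R + 1 - x + N%:R)^-1).
Proof.
move=> /andP[x0 x1]; have xI : 0 <= x <= 1 by lra.
have wx : weight (1 - x) = weight x by rewrite /weight; ring.
have /andP[w1 _] := weight_bounds xI.
elim: N => [|N IH].
  by rewrite big_geq // !addr0 density_weight // mulfV ?subrr // gt_eqF //; lra.
have N0 : 0 <= N%:R :> R by [].
have e2 : N.+2%:R = N%:R + 2 :> R by rewrite -addn2 natrD.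
rewrite big_nat_recr //= IH /branch_pair /branch wx /= !mulr1 !quadV; try by rewrite e2; lra.
rewrite e2 -(natr1 N) (_ : N%:R + 2 + x + golden R - 2 = golden R + x + N%:R); last ring.
rewrite (_ : N%:R + 2 + x + golden R - 1 = golden R + x + (N%:R + 1)); last ring.
rewrite (_ : N%:R + 2 + (1 - x) + golden R - 2 = golden R + 1 - x + N%:R); last ring.
rewrite (_ : N%:R + 2 + (1 - x) + golden R - 1 = golden R + 1 - x + (N%:R + 1)); last ring.
ring.
Qed.

(** The operator [U], with [k = j + 2]; [is_cvg_transfer] gives the limit its meaning for Lipschitz
    [g]. *)
Definition transfer g x : R := limn (series (fun j => branch_pair j.+2%:R g x)).

Lemma cvg_transfer1 x : 0 <= x <= 1 / 2 ->
  series (fun j => branch_pair j.+2%:R (cst 1) x) @ \oo --> (1 : R).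
Proof.
move=> xI; have -> : series (fun j => branch_pair j.+2%:R (cst 1) x) =
  (fun N => 1 - weight x * ((golden R + x + N%:R)^-1 + (golden R + 1 - x + N%:R)^-1)).
  by apply/funext => N; rewrite /series /= sum_branch_pair1.
have inv_cvg c : 1 <= c -> (fun N => (c + N%:R)^-1) @ \oo --> (0 : R).
  move=> c1; apply: (@squeeze_cvgr _ _ _ _ (cst 0) (@harmonic R)).
  - near=> N; rewrite /harmonic /=.
    have N0 : 0 <= N%:R :> R by [].
    by rewrite invr_ge0 lef_pV2 ?posrE -?natr1; try (apply/andP; split); lra.
  - exact: cvg_cst.
  - exact: cvg_harmonic.
have /andP[G1 _] := golden_bounds; move: xI => /andP[x0 x1].
rewrite -[X in _ --> X](_ : 1 - weight x * (0 + 0) = 1); last by rewrite addr0 mulr0 subr0.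
apply: cvgB; first exact: cvg_cst.
by apply: cvgM; [exact: cvg_cst | apply: cvgD; apply: inv_cvg; lra].
Unshelve. all: by end_near. Qed.

Lemma branch_ge0 k g z : 2 <= k -> 0 <= z <= 1 -> (forall u, 0 <= u <= 1 / 2 -> 0 <= g u) ->
  0 <= branch k g z.
Proof.
move=> k2 zI g0; have /andP[w1 _] := weight_bounds zI; move: zI => /andP[z0 z1].
rewrite /branch mulr_ge0 ?divr_ge0 ?(ltW (quad_gt0 _)) ?g0 ?inv_half //; lra.
Qed.

Lemma branch_pair_ge0 k g x : 2 <= k -> 0 <= x <= 1 / 2 ->
  (forall u, 0 <= u <= 1 / 2 -> 0 <= g u) -> 0 <= branch_pair k g x.
Proof.
by move=> k2 /andP[x0 x1] g0; rewrite /branch_pair addr_ge0 // branch_ge0 //; lra.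
Qed.

Lemma lip_bounded M g : 0 <= M -> lip M g ->
  exists2 B, 0 <= B & forall u, 0 <= u <= 1 / 2 -> `|g u| <= B.
Proof.
move=> M0 gM; exists (`|g 0| + M) => [|u uI]; first by rewrite addr_ge0.
have := gM u 0 uI ltac:(lra); move: (uI) => /andP[u0 u1]; rewrite subr0 (ger0_norm u0) => gu.
have Mu : M * u <= M by rewrite -[leRHS]mulr1 ler_wpM2l //; lra.
have := ler_normD (g u - g 0) (g 0); rewrite subrK; lra.
Qed.

(** Comparison with the convergent series of the constant 1, scaled by a bound of [g]. *)
Lemma is_cvg_transfer M g x : 0 <= M -> lip M g -> 0 <= x <= 1 / 2 ->
  cvgn (series (fun j => branch_pair j.+2%:R g x)).
Proof.
move=> M0 gM xI; have [B B0 gB] := lip_bounded M0 gM.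
have k2 j : 2 <= j.+2%:R :> R by rewrite ler_nat.
apply: normed_cvg.
apply: (@series_le_cvg _ _ (fun j => B * branch_pair j.+2%:R (cst 1) x)) => [j|j|j|].
- exact: normr_ge0.
- by rewrite mulr_ge0 // branch_pair_ge0 //= => *; lra.
- move: xI => /andP[x0 x1].
  have h z : 0 <= z <= 1 -> `|branch j.+2%:R g z| <= B * branch j.+2%:R (cst 1) z.
    move=> zI; have := branch_ge0 (g := cst 1) (k2 j) zI (fun _ _ => ler01).
    rewrite /branch /= mulr1 => q0; rewrite normrM (ger0_norm q0) mulrC ler_wpM2r //.
    by apply/gB/inv_half; have := k2 j; lra.
  rewrite /branch_pair mulrDr; apply: (le_trans (ler_normD _ _)).
  by apply: lerD; apply: h; lra.
- apply: is_cvg_seriesZ; apply: cvgP; exact: cvg_transfer1.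
Qed.

Lemma transfer_ge0 M g x : 0 <= M -> lip M g -> (forall u, 0 <= u <= 1 / 2 -> 0 <= g u) ->
  0 <= x <= 1 / 2 -> 0 <= transfer g x.
Proof.
move=> M0 gM g0 xI; apply: limr_ge; first exact: (is_cvg_transfer M0 gM xI).
by near=> N; apply: sumr_ge0 => j _; apply: branch_pair_ge0 => //; rewrite ler_nat.
Unshelve. all: by end_near. Qed.

Lemma transfer_lip M g : 0 <= M -> lip M g -> lip (288 / 1000 * M) (transfer g).
Proof.
move=> M0 gM x y xI yI; set c := g (1 / 3).
pose g' u := g u - c.
have g'M : lip M g'.
  by move=> u v uI vI; rewrite (_ : g' u - g' v = g u - g v); [exact: gM | rewrite /g'; ring].
have g'0 : g' (1 / 3) = 0 by rewrite /g' subrr.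
pose S g x := series (fun j => branch_pair j.+2%:R g x).
have SE z N : S g z N = S g' z N + c * S (cst 1) z N.
  rewrite /S /series /= mulr_sumr -big_split /=; apply: eq_bigr => j _.
  by rewrite /branch_pair /branch /g' /=; ring.
have l1 := is_cvg_transfer M0 gM xI; have l2 := is_cvg_transfer M0 gM yI.
have lim1 : (fun N => `|S g x N - S g y N|) @ \oo --> `|transfer g x - transfer g y|.
  by apply: cvg_norm; apply: cvgB.
(* In a partial sum the constant [c] still contributes; its series at [x] and at [y] both tend to 1,
   so this error vanishes in the limit. *)
have lim2 : (fun N => 288 / 1000 * (M * `|x - y|) + `|c * (S (cst 1) x N - S (cst 1) y N)|) @ \oo -->
    288 / 1000 * (M * `|x - y|) + `|c * (1 - 1)|.
  apply: cvgD; first exact: cvg_cst.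
  apply: cvg_norm; apply: cvgM; first exact: cvg_cst.
  by apply: cvgB; exact: cvg_transfer1.
have c0 : `|c * (1 - 1)| = 0 by rewrite subrr mulr0 normr0.
rewrite -[X in _ <= X]mulrA -[leRHS]addr0 -[X in _ <= _ + X]c0.
apply: (ler_cvg_to lim1 lim2); near=> N.
rewrite !SE opprD addrACA -mulrBr; apply: (le_trans (ler_normD _ _)); rewrite lerD2r.
exact: sum_branch_pair_lip.
Unshelve. all: by end_near. Qed.

End transfer.

(** * Change of variables along one branch *)

Section measures.
Context (R : realType).
Local Notation mu := (@lebesgue_measure R).
Local Notation I := (@half_interval R).

(** The push-forward along [psi] of the density [f] on [D], packaged as a measure so that uniqueness
    of measures can be applied to it. *)
Lemma integral_preimage_measure (D : set R) (psi f : R -> R) :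
  measurable D -> measurable_fun D psi -> measurable_fun D f ->
  (forall x, D x -> 0 <= f x) ->
  exists m : {measure set (measurableTypeR R) -> \bar R},
    forall A, m A = (\int[mu]_(x in D `&` psi @^-1` A) (f x)%:E)%E.
Proof.
move=> mD mpsi mf f0.
pose m (A : set (measurableTypeR R)) := (\int[mu]_(x in D `&` psi @^-1` A) (f x)%:E)%E.
have m0 : m set0 = 0%E by rewrite /m preimage_set0 setI0 integral_set0.
have mge0 A : (0 <= m A)%E.
  by apply: integral_ge0 => x [Dx _]; rewrite lee_fin f0.
have msigma : semi_sigma_additive m.
  move=> F mF tF mUF; rewrite /m.
  apply: cvg_toP.
    apply: ereal_nondecreasing_is_cvgn => i j ij.
    by apply: lee_sum_nneg_natr => // k _ _; exact: (mge0 (F k)).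
  rewrite preimage_bigcup setI_bigcupr ge0_integral_bigcup //.
  - by move=> k; exact: (mpsi mD _ (mF k)).
  - apply/measurable_EFinP; apply: measurable_funS mf => // x [k _ []//].
  - by move=> x [k _ [Dx _]]; rewrite lee_fin f0.
  - move=> i j _ _ [x [[_ xi] [_ xj]]]; apply: (tF i j) => //.
    by exists (psi x).
pose M := isMeasure.Build _ _ _ m m0 mge0 msigma.
by exists (HB.pack_for {measure set (measurableTypeR R) -> \bar R} m M).
Qed.

(** Closed right rays are stable under intersection, generate the Borel sets, and the rays from
    [- n] exhaust the line. *)
Lemma measure_eq_ray (m1 m2 : {measure set (measurableTypeR R) -> \bar R}) :
  (forall b : R, m1 `[b, +oo[%classic = m2 `[b, +oo[%classic) -> (m1 setT < +oo)%E ->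
  forall A, measurable A -> m1 A = m2 A.
Proof.
move=> m12 fin A mA.
apply: (@measure_unique _ R (measurableTypeR R) (@RGenCInfty.G R)
  (fun n : nat => `[- n%:R, +oo[%classic)) => //.
- exact: RGenCInfty.measurableE.
- move=> _ _ [x ->] [y ->]; exists (Num.max x y).
  by apply/seteqP; split => z /=; rewrite !in_itv /= !andbT ge_max => /andP.
- by move=> n; exists (- n%:R).
- apply/seteqP; split => // x _; exists (Num.truncn `|x|).+1 => //=.
  rewrite in_itv /= andbT lerNl; apply: (le_trans (ler_norm _)); rewrite normrN.
  exact/ltW/truncnS_gt.
- by move=> _ [b ->].
- by move=> n; apply: le_lt_trans fin; apply: le_measure; rewrite ?inE.
Qed.

Lemma lip_within_continuous (M : R) (g : R -> R) : 0 <= M -> lip M g ->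
  {within I, continuous g}.
Proof.
move=> M0 gM; apply/subspace_continuousP => x; rewrite /half_interval /= in_itv /= => xI.
apply/cvgrPdist_lt => e e0; rewrite near_withinE.
(* [M + 1] keeps the denominator positive when [M = 0]. *)
apply/nbhs_ballP; exists (e / (M + 1)) => /=; first by rewrite divr_gt0 //; lra.
move=> y; rewrite /ball /= => xy; rewrite in_itv /= => yI.
apply: (le_lt_trans (gM x y xI yI)).
move: xy; rewrite ltr_pdivlMr; last lra.
have := normr_ge0 (x - y); nra.
Qed.

(** The inverse branch of [T] for the digit [(a, e)]. Real parameters let it also express [x^-1] and
    the two terms of the invariant density. *)
Definition phi (a e y : R) : R := (a + e * y)^-1.

Lemma is_derive_affine (a e y : R) : is_derive y 1 (fun y => a + e * y) e.
Proof.
have h1 : is_derive y (1 : R) (fun y : R => e * y) (e *: (1 : R)).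
  exact: (is_deriveZ e (is_derive_id y 1)).
apply: (is_derive_eq (is_deriveD (is_derive_cst a y 1) h1)).
by rewrite add0r [LHS]mulr1.
Qed.

Lemma is_derive_phi (a e y : R) : 0 < a + e * y ->
  is_derive y 1 (phi a e) (- e * phi a e y ^+ 2).
Proof.
move=> ay; have n0 : a + e * y != 0 by rewrite gt_eqF.
have [d1 d2] := is_derive_affine a e y; split; first by apply: derivableV.
rewrite deriveV // d2 /phi exprVn; set X := _ ^- 2.
by rewrite -[LHS]/(- X * e) mulNr mulNr mulrC.
Qed.

Lemma continuous_phi (a e y : R) : 0 < a + e * y -> {for y, continuous (phi a e)}.
Proof.
move=> ay; apply: differentiable_continuous; apply/derivable1_diffP.
by have [] := is_derive_phi ay.
Qed.

Lemma cvg_derive_phi (a e y : R) : 0 < a + e * y ->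
  derive1 (phi a e) x @[x --> y] --> - e * phi a e y ^+ 2.
Proof.
move=> ay; have cphi := continuous_phi ay.
apply: (@cvg_trans _ ((fun x => - e * phi a e x ^+ 2) x @[x --> y])).
  apply: near_eq_cvg; near=> x.
  have ax : 0 < a + e * x.
    near: x; apply: (@cvgr_gt _ _ _ _ (fun x => a + e * x) (a + e * y)) => //.
    by apply: cvgD; [exact: cvg_cst | apply: cvgM; [exact: cvg_cst | exact: cvg_id]].
  by rewrite derive1E; have [_ ->] := is_derive_phi ax.
apply: (@cvgM _ _ (nbhs y) _ (cst (- e)) (fun x => phi a e x ^+ 2)); first exact: cvg_cst.
exact: (@cvgM _ _ (nbhs y) _ (phi a e) (phi a e)).
Unshelve. all: by end_near. Qed.

End measures.

(** * Invariant density along the inverse branches *)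

Section inverse_branches.
Context (R : realType).
Local Notation mu := (@lebesgue_measure R).
Local Notation I := (@half_interval R).
Local Notation dens := (@nicf_density R).
Local Notation T := (@nicf_map R).

Lemma half_intervalP (x : R) : I x <-> 0 <= x <= 1 / 2.
Proof. by rewrite /half_interval /= in_itv. Qed.

Lemma ln_golden_gt0 : 0 < ln (golden R).
Proof. by rewrite ln_gt0 //; have /andP[] := golden_bounds R; lra. Qed.

Lemma densE (x : R) : 0 <= x <= 1 -> dens x = (ln (golden R))^-1 / weight x.
Proof. by move=> xI; rewrite /nicf_density density_weight. Qed.

Lemma dens_ge0 (x : R) : I x -> 0 <= dens x.
Proof.
move/half_intervalP => xI; have xI' : 0 <= x <= 1 by lra.
have /andP[w1 _] := weight_bounds xI'.
by rewrite densE // divr_ge0 ?invr_ge0 ?(ltW ln_golden_gt0) //; lra.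
Qed.

Lemma dens_continuous : {within I, continuous dens}.
Proof.
have /andP[G1 _] := golden_bounds R.
apply: continuous_in_subspaceT => x; rewrite inE => /half_intervalP /andP[x0 x1].
have -> : dens = (fun x => (ln (golden R))^-1 * (phi (golden R) 1 x + phi (golden R + 1) (-1) x)).
  by apply/funext => y; rewrite /nicf_density /phi mul1r mulN1r.
apply: (@cvgM _ _ (nbhs x) _ (cst (ln (golden R))^-1)); first exact: cvg_cst.
by apply: cvgD; apply: continuous_phi; lra.
Qed.

Lemma lip_dens_continuous (M : R) (g : R -> R) : 0 <= M -> lip M g ->
  {within I, continuous (fun x => g x * dens x)}.
Proof.
move=> M0 gM x; apply: cvgM; first exact: lip_within_continuous M0 gM x.
exact: dens_continuous.
Qed.

Lemma lip_dens_measurable (M : R) (g : R -> R) : 0 <= M -> lip M g ->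
  measurable_fun I (fun x => g x * dens x).
Proof.
move=> M0 gM; apply: subspace_continuous_measurable_fun; first exact: measurable_itv.
exact: lip_dens_continuous M0 gM.
Qed.

(** This is [quad b = b ^+ 2 * weight b^-1] at [b = k + z]. *)
Lemma dens_pullback (k z : R) : 2 <= k -> 0 <= z <= 1 ->
  dens (k + z)^-1 * (k + z)^-1 ^+ 2 = (ln (golden R))^-1 / quad (k + z).
Proof.
move=> k2 /andP[z0 z1]; have b2 : 2 <= k + z by lra.
have uI := inv_half b2; rewrite densE; last lra.
rewrite exprVn -mulrA -invfM; congr (_ * _^-1).
rewrite /weight /quad; field; rewrite gt_eqF //; lra.
Qed.

Definition good_digit (a e : R) := (e = 1 /\ 2 <= a) \/ (e = -1 /\ 3 <= a).

Definition digit_branch (a e : R) (g : R -> R) (y : R) : R :=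
  if e == 1 then branch a g y else branch (a - 1) g (1 - y).

(** The integrand of the change of variables, [phi ^+ 2] being the absolute value of the derivative
    of [phi]. For [e = -1] the symmetry of the density under [y |-> 1 - y] and
    [a - y = (a - 1) + (1 - y)] reduce it to the same computation. *)
Lemma digit_branchE (a e y : R) g : good_digit a e -> 0 <= y <= 1 / 2 ->
  digit_branch a e g y * dens y = g (phi a e y) * dens (phi a e y) * phi a e y ^+ 2.
Proof.
have h k z (k2 : 2 <= k) (zI : 0 <= z <= 1) : branch k g z * dens z =
    g (k + z)^-1 * dens (k + z)^-1 * (k + z)^-1 ^+ 2.
  rewrite -mulrA dens_pullback // densE // /branch.
  have /andP[w1 _] := weight_bounds zI.
  have : quad (k + z) != 0 by rewrite gt_eqF // quad_gt0 //; move/andP: zI => []; lra.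
  have := ln_golden_gt0.
  move: (weight z) w1 (quad _) (ln _) => w w1 q l l0 q0.
  by field; rewrite q0 !gt_eqF //; lra.
rewrite /digit_branch /phi => -[[-> a2]|[-> a3]] yI.
  by rewrite eqxx mul1r h //; lra.
rewrite ifF; last by apply/negbTE; rewrite lt_eqF //; lra.
have -> : dens y = dens (1 - y).
  by rewrite /nicf_density; congr (_ * _); rewrite addrC; congr (_^-1 + _^-1); ring.
rewrite h; [ | lra | lra].
by rewrite (_ : a - 1 + (1 - y) = a + -1 * y) //; ring.
Qed.

Lemma good_digit_ge2 (a e y : R) : good_digit a e -> 0 <= y <= 1 / 2 -> 2 <= a + e * y.
Proof. by move=> [[-> a2]|[-> a3]] /andP[y0 y1]; lra. Qed.

Lemma phi_half (a e y : R) : good_digit a e -> I y -> I (phi a e y).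
Proof.
move=> de /half_intervalP yI; apply/half_intervalP; apply: inv_half.
exact: good_digit_ge2.
Qed.

Lemma phi_image (a e c : R) : good_digit a e -> 0 <= c <= 1 / 2 ->
  [set phi a e y | y in `[c, 1 / 2]%classic] =
  if e == 1 then `[phi a e (1 / 2), phi a e c]%classic
  else `[phi a e c, phi a e (1 / 2)]%classic.
Proof.
move=> de cI; have c2 := good_digit_ge2 de cI.
have h2 : 2 <= a + e * (1 / 2) by apply: good_digit_ge2 => //; lra.
have inv_le (u v : R) : 2 <= u -> u <= v -> v^-1 <= u^-1.
  by move=> *; rewrite lef_pV2 ?posrE //; lra.
move: cI => /andP[c0 c1]; case: de => -[eE aE]; subst e.
  rewrite eqxx; apply/seteqP; split => [_ [y /=] + <-|x /=]; rewrite !in_itv /= /phi !mul1r in c2 h2 *.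
    by move=> /andP[cy y1]; rewrite !inv_le //; lra.
  move=> /andP[xl xu].
  have x0 : 0 < x by apply: lt_le_trans xl; rewrite invr_gt0; lra.
  exists (x^-1 - a); last by rewrite ?mul1r (addrC a) subrK invrK.
  rewrite in_itv /=.
  have : x^-1 <= a + 2^-1 by rewrite -[leRHS]invrK lef_pV2 ?posrE ?invr_gt0 //; lra.
  have : a + c <= x^-1 by rewrite -[leLHS]invrK lef_pV2 ?posrE ?invr_gt0 //; lra.
  by lra.
rewrite ifF; last by apply/negbTE; rewrite lt_eqF //; lra.
apply/seteqP; split => [_ [y /=] + <-|x /=]; rewrite !in_itv /= /phi !mulN1r in c2 h2 *.
  by move=> /andP[cy y1]; rewrite !inv_le //; lra.
move=> /andP[xl xu].
have x0 : 0 < x by apply: lt_le_trans xl; rewrite invr_gt0; lra.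
exists (a - x^-1); last by rewrite ?mulN1r opprB (addrC a) subrK invrK.
rewrite in_itv /=.
have : a - 1 / 2 <= x^-1 by rewrite -[leLHS]invrK lef_pV2 ?posrE ?invr_gt0 //; lra.
have : x^-1 <= a - c by rewrite -[leRHS]invrK lef_pV2 ?posrE ?invr_gt0 //; lra.
by lra.
Qed.

(** Substitution, decreasing for [e = 1] and increasing for [e = -1]. Intervals ending at [1/2] are
    enough because they are the traces of right rays on [[0, 1/2]]. *)
Lemma integral_phi_image (a e c : R) (f : R -> R) : good_digit a e -> 0 <= c <= 1 / 2 ->
  {within I, continuous f} ->
  (\int[mu]_(x in [set phi a e y | y in `[c, (1 / 2)%R]%classic]) (f x)%:E =
   \int[mu]_(y in `[c, (1 / 2)%R]%classic) (f (phi a e y) * phi a e y ^+ 2)%:E)%E.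
Proof.
move=> de cI cf; rewrite phi_image //; move: (cI) => /andP[c0 c1].
have pos y : y \in `[c, 1 / 2] -> 0 < a + e * y.
  rewrite in_itv /= => yI; have := @good_digit_ge2 a e y de; lra.
have cin : c \in `[c, 1 / 2] by rewrite in_itv /= lexx c1.
have hin : 1 / 2 \in `[c, 1 / 2] by rewrite in_itv /= lexx c1.
have oc y : y \in `]c, 1 / 2[ -> y \in `[c, 1 / 2] by exact: subset_itv_oo_cc.
have d1 : {in `]c, 1 / 2[, continuous (derive1 (phi a e))}.
  move=> y /oc yc; have [_ dy] := is_derive_phi (pos _ yc).
  by rewrite /continuous_at derive1E dy; exact: cvg_derive_phi (pos _ yc).
have d2 : cvg (derive1 (phi a e) x @[x --> c^'+]).
  by apply/cvg_ex; eexists; apply: cvg_at_right_filter; apply: cvg_derive_phi; exact: pos.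
have d3 : cvg (derive1 (phi a e) x @[x --> (1 / 2)^'-]).
  by apply/cvg_ex; eexists; apply: cvg_at_left_filter; apply: cvg_derive_phi; exact: pos.
have d4 : derivable_oo_LRcontinuous (phi a e) c (1 / 2).
  split.
  - by move=> y /oc yc; have [] := is_derive_phi (pos _ yc).
  - by apply: cvg_at_right_filter; apply: continuous_phi; exact: pos.
  - by apply: cvg_at_left_filter; apply: continuous_phi; exact: pos.
have sub : [set phi a e y | y in `[c, 1 / 2]%classic] `<=` I.
  move=> _ [y /=] + <-; rewrite in_itv /= => yI; apply: phi_half => //; apply/half_intervalP; lra.
have inv_lt (u v : R) : 0 < u -> u < v -> v^-1 < u^-1.
  by move=> *; rewrite ltf_pV2 ?posrE //; lra.
have derE y : y \in `[c, 1 / 2]%classic -> derive1 (phi a e) y = - e * phi a e y ^+ 2.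
  by rewrite inE /= => yI; rewrite derive1E; have [_ ->] := is_derive_phi (pos _ yI).
have cf' := continuous_subspaceW sub cf; rewrite phi_image // in cf'.
case: (de) => -[eE aE].
  have e1 : (e == 1) = true by rewrite eE eqxx.
  rewrite e1 in cf' *.
  rewrite integration_by_substitution_decreasing //.
    by apply: eq_integral => y yI; congr (_%:E); rewrite !fctE /= derE // eE mulN1r opprK.
  by move=> x y xI yI xy; apply: inv_lt; [exact: pos | rewrite eE; lra].
have e1 : (e == 1) = false by apply/negbTE; rewrite eE lt_eqF //; lra.
rewrite e1 in cf' *.
rewrite integration_by_substitution_increasing //.
  by apply: eq_integral => y yI; congr (_%:E); rewrite !fctE /= derE // eE opprK mul1r.
by move=> x y xI yI xy; apply: inv_lt; [exact: pos | rewrite eE; lra].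
Qed.

End inverse_branches.

(** * Duality for a single digit *)

Section digit_transfer.
Context (R : realType).
Local Notation mu := (@lebesgue_measure R).
Local Notation I := (@half_interval R).
Local Notation dens := (@nicf_density R).
Local Notation T := (@nicf_map R).
Local Notation phid d := (phi (d.1%:~R : R) (d.2%:~R : R)).

Lemma nicf_digit_good (d : int * int) : nicf_digit d ->
  good_digit (d.1%:~R : R) (d.2%:~R : R).
Proof.
move=> [[d1 ->]|[d1 ->]]; [left|right]; split => //.
  by rewrite -[2]/(2%:~R) ler_int.
by rewrite -[3]/(3%:~R) ler_int.
Qed.

Lemma cylinder1E (d : int * int) :
  @cylinder1 R d = [set phid d y | y in `[(0 : R), 1 / 2]%classic].
Proof. by rewrite /cylinder1 /phi /half_interval; apply: eq_imagel => y _; rewrite div1r. Qed.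

Lemma nicf_map_phi (d : int * int) (y : R) : nicf_digit d -> I y -> T (phid d y) = y.
Proof.
move=> dd /half_intervalP yI; have gd := nicf_digit_good dd.
have ge2 := good_digit_ge2 gd yI; move: yI => /andP[y0 y1].
rewrite /nicf_map ifF; last by rewrite /phi invr_eq0 gt_eqF //; lra.
rewrite /phi invrK; case: dd gd => -[d1 d2] gd; rewrite d2 in ge2 *.
  (* At [y = 1/2] with sign [1] the rounding goes up to [d.1 + 1], but the distance to that integer
     is again [1/2]. *)
  have [yl|yg] := ltP y (1 / 2).
    rewrite (_ : Num.floor _ = d.1); last by apply: floor_def; rewrite intrD; apply/andP; split; lra.
    by rewrite mul1r addrAC subrr add0r ger0_norm.
  rewrite (_ : Num.floor _ = d.1 + 1); last by apply: floor_def; rewrite !intrD; apply/andP; split; lra.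
  by rewrite intrD ler0_norm; lra.
rewrite (_ : Num.floor _ = d.1); last first.
  by apply: floor_def; rewrite intrD mulrNz; apply/andP; split; lra.
by rewrite mulrNz mulN1r addrAC subrr add0r normrN ger0_norm.
Qed.

Lemma nicf_map_half (x : R) : I (T x).
Proof.
apply/half_intervalP; rewrite /nicf_map; case: ifP => _; first lra.
have /andP[] := floor_itv (x^-1 + 1 / 2); rewrite intrD normr_ge0 /= => h1 h2.
by rewrite ler_norml; apply/andP; split; lra.
Qed.

Lemma cylinder1_half (d : int * int) : nicf_digit d -> @cylinder1 R d `<=` I.
Proof.
by move=> dd _ [y yI <-]; rewrite div1r; apply: phi_half => //; exact: nicf_digit_good.
Qed.

Lemma measurable_cylinder1 (d : int * int) : nicf_digit d -> measurable (@cylinder1 R d).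
Proof.
move=> dd; rewrite cylinder1E phi_image; last 2 first.
- exact: nicf_digit_good.
- lra.
by case: ifP => _; exact: measurable_itv.
Qed.

Lemma measurable_nicf_map_cylinder1 (d : int * int) : nicf_digit d ->
  measurable_fun (@cylinder1 R d) T.
Proof.
move=> dd; have gd := nicf_digit_good dd; have mJ := measurable_cylinder1 dd.
(* Solving [x = 1 / (a + e y)] for [y] gives [e (1 / x - a)], as [e ^ 2 = 1]; this formula is
   continuous on the cylinder. *)
apply: (@eq_measurable_fun _ _ _ _ _ (fun x => d.2%:~R * (phi 0 1 x - d.1%:~R))) => [x|].
  rewrite inE => -[y yI <-]; rewrite div1r -/(phi _ _ _) nicf_map_phi //.
  rewrite /phi mul1r add0r invrK (addrAC d.1%:~R) subrr add0r mulrA.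
  by case: gd => -[-> _]; rewrite ?mul1r // mulrNN !mul1r.
apply: subspace_continuous_measurable_fun => //.
apply: continuous_in_subspaceT => x; rewrite inE => -[y yI <-].
apply: (@cvgM _ _ (nbhs _) _ (cst d.2%:~R)); first exact: cvg_cst.
apply: cvgB; last exact: cvg_cst.
apply: continuous_phi; rewrite add0r mul1r div1r invr_gt0.
by have := good_digit_ge2 gd ((half_intervalP _).1 yI); lra.
Qed.

(** Purely qualitative: a single branch of [g] stays Lipschitz. Passing to [M + 1 > 0] allows a
    bound [B] of [g] to be written as [(M + 1) * d], the form that [branch_lip] takes. *)
Lemma digit_branch_lip (a e M : R) (g : R -> R) : good_digit a e -> 0 <= M -> lip M g ->
  exists2 M', 0 <= M' & lip M' (digit_branch a e g).
Proof.
move=> gd M0 gM; have [B B0 gB] := lip_bounded M0 gM.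
have M1 : 0 <= M + 1 by lra.
have gM1 : lip (M + 1) g.
  move=> x y xI yI; apply: (le_trans (gM x y xI yI)); rewrite ler_wpM2r //; lra.
pose d := B / (M + 1); have d0 : 0 <= d by rewrite divr_ge0.
have Bd : B = (M + 1) * d by rewrite /d mulrC divfK // gt_eqF //; lra.
have K0 : 0 <= kappa 2 d.
  rewrite /kappa /=; set s := 2 ^+ 2 + _.
  have s0 : 0 <= s by rewrite /s; lra.
  by apply: addr_ge0; [|apply: mulr_ge0 => //; apply: addr_ge0]; apply: divr_ge0 => //;
    rewrite ?sqr_ge0 ?mulr_ge0 ?sqr_ge0 //; lra.
exists (kappa 2 d * (M + 1)); first by rewrite mulr_ge0.
have key k z1 z2 : 2 <= k -> 0 <= z1 <= 1 -> 0 <= z2 <= 1 ->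
    `|branch k g z1 - branch k g z2| <= kappa 2 d * (M + 1) * `|z1 - z2|.
  move=> k2 z1I z2I; rewrite -mulrA; apply: branch_lip => //; try lra.
  by rewrite -Bd; apply: gB; apply: inv_half; lra.
move=> x y xI yI; rewrite /digit_branch; case: gd => -[-> a2].
  by rewrite eqxx; apply: key; lra.
have -> : (-1 == 1 :> R) = false by apply/negbTE; rewrite lt_eqF //; lra.
rewrite (_ : `|x - y| = `|(1 - x) - (1 - y)|); last by rewrite -normrN; congr `| _ |; ring.
by apply: key; lra.
Qed.

Lemma digit_branch_ge0 (a e : R) (g : R -> R) : good_digit a e -> 
  (forall u, 0 <= u <= 1 / 2 -> 0 <= g u) ->
  forall u, 0 <= u <= 1 / 2 -> 0 <= digit_branch a e g u.
Proof.
move=> gd g0 u uI; rewrite /digit_branch; case: gd => -[-> a2].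
  by rewrite eqxx branch_ge0 //; lra.
rewrite ifF; last by apply/negbTE; rewrite lt_eqF //; lra.
by rewrite branch_ge0 //; lra.
Qed.

Lemma lip_dens_integrable (M : R) (g : R -> R) : 0 <= M -> lip M g ->
  mu.-integrable I (EFin \o (fun x => g x * dens x)).
Proof.
move=> M0 gM; apply: continuous_compact_integrable; first exact: segment_compact.
exact: lip_dens_continuous M0 gM.
Qed.

(** Both sides are finite measures in [A], so it suffices to compare them on rays, where the claim
    is the substitution [integral_phi_image]. *)
Lemma integral_cylinder1 (d : int * int) (M : R) (g : R -> R) (A : set R) :
  nicf_digit d -> 0 <= M -> lip M g -> (forall u, 0 <= u <= 1 / 2 -> 0 <= g u) ->
  measurable A ->
  (\int[mu]_(x in @cylinder1 R d `&` T @^-1` A) (g x * dens x)%:E =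
   \int[mu]_(x in I `&` A) (digit_branch d.1%:~R d.2%:~R g x * dens x)%:E)%E.
Proof.
move=> dd M0 gM g0 mA; have gd := nicf_digit_good dd.
have [M' M'0 gM'] := digit_branch_lip gd M0 gM.
have g'0 := digit_branch_ge0 gd g0.
have mJ := measurable_cylinder1 dd.
have mI : measurable I by exact: measurable_itv.
have mf : measurable_fun (@cylinder1 R d) (fun x => g x * dens x).
  by apply: measurable_funS (lip_dens_measurable M0 gM) => //; exact: cylinder1_half.
have [m1 m1E] := integral_preimage_measure mJ (measurable_nicf_map_cylinder1 dd) mf
  (fun x Jx => mulr_ge0 (g0 x ((half_intervalP x).1 (cylinder1_half dd Jx))) (dens_ge0 (cylinder1_half dd Jx))).
have [m2 m2E] := integral_preimage_measure mI (@measurable_id _ _ I) (lip_dens_measurable M'0 gM')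
  (fun x Ix => mulr_ge0 (g'0 x ((half_intervalP x).1 Ix)) (dens_ge0 Ix)).
suff : m1 A = m2 A by rewrite m1E m2E preimage_id.
apply: measure_eq_ray => //.
- move=> b; rewrite m1E m2E preimage_id.
  (* The ray from [b] meets [[0, 1/2]] in [[c, 1/2]]; for [c > 1/2] both domains are empty. *)
  pose c := Num.max b 0.
  have [c1|c1] := leP c (1 / 2); last first.
    rewrite (_ : @cylinder1 R d `&` _ = set0); last first.
      apply/seteqP; split => // _ [[y yI <-]] /=; rewrite div1r nicf_map_phi // in_itv /= andbT => yb.
      by move: yI => /half_intervalP /andP[y0 y1]; move: c1; rewrite lt_max => /orP[]; lra.
    rewrite (_ : I `&` _ = set0) ?integral_set0 //.
    apply/seteqP; split => // y [/half_intervalP yI] /=; rewrite in_itv /= andbT => yb.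
    by move: yI => /andP[y0 y1]; move: c1; rewrite lt_max => /orP[]; lra.
  have cI : 0 <= c <= 1 / 2 by rewrite c1 le_max lexx orbT.
  have IcE : I `&` `[b, +oo[%classic = `[c, (1 / 2)]%classic.
    apply/seteqP; split => y /=; rewrite /half_interval /= !in_itv /= ?andbT /c ge_max.
      by move=> [/andP[-> ->] ->].
    by move=> /andP[/andP[-> ->] ->].
  rewrite IcE -[X in integral _ X _ = _](_ : [set phid d y | y in `[c, 1 / 2]%classic] = _).
    rewrite integral_phi_image //; last exact: lip_dens_continuous M0 gM.
    apply: eq_integral => y; rewrite inE /= in_itv /= => yI; rewrite digit_branchE //; lra.
  apply/seteqP; split.
    move=> _ [y + <-]; rewrite -IcE => -[yI yb]; split; first by exists y => //; rewrite div1r.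
    by rewrite /= nicf_map_phi.
  move=> _ [[y yI <-]]; rewrite div1r /= -/(phi _ _ _) nicf_map_phi // => yb.
  by exists y => //; have : (I `&` `[b, +oo[%classic) y by []; rewrite IcE.
- rewrite m1E preimage_setT setIT.
  apply: integrable_lty => //; apply: integrableS (lip_dens_integrable M0 gM) => //.
  exact: cylinder1_half.
Qed.

End digit_transfer.

(** * Partition into cylinders of rank one *)

Section partition.
Context (R : realType).
Local Notation mu := (@lebesgue_measure R).
Local Notation I := (@half_interval R).
Local Notation dens := (@nicf_density R).
Local Notation T := (@nicf_map R).

(** With [k = j + 2], the digits [(k, 1)] and [(k + 1, -1)] share the index [j]: they form one
    [branch_pair], and their cylinders meet at [1 / (k + 1/2)]. *)
Definition plus_digit (j : nat) : int * int := (j.+2%:Z, 1).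
Definition minus_digit (j : nat) : int * int := (j.+3%:Z, -1).

Lemma plus_digitP j : nicf_digit (plus_digit j).
Proof. by left; split. Qed.

Lemma minus_digitP j : nicf_digit (minus_digit j).
Proof. by right; split. Qed.

Lemma cylinder1_plus j : @cylinder1 R (plus_digit j) =
  `[(j.+2%:R + 1 / 2)^-1, j.+2%:R^-1]%classic.
Proof.
rewrite cylinder1E phi_image; [|exact/nicf_digit_good/plus_digitP|lra].
by rewrite /phi /= eqxx mul1r mul1r mulr0 addr0.
Qed.

Lemma cylinder1_minus j : @cylinder1 R (minus_digit j) =
  `[j.+3%:R^-1, (j.+2%:R + 1 / 2)^-1]%classic.
Proof.
rewrite cylinder1E phi_image; [|exact/nicf_digit_good/minus_digitP|lra].
have e : (-1 == 1 :> R) = false by apply/negbTE; rewrite lt_eqF //; lra.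
rewrite /phi /= mulrNz e mulr0 addr0 (_ : j.+3%:~R + _ = j.+2%:R + 1 / 2) //.
by rewrite -[j.+3%:~R]/(j.+3%:R) -(natr1 j.+2); field.
Qed.

(** The piece of index [j] is where the integer part of [1 / x] equals [j + 2]. *)
Lemma half_interval_pieces :
  `]0, (1 / 2 : R)]%classic = \bigcup_j `](j.+3%:R : R)^-1, j.+2%:R^-1]%classic.
Proof.
apply/seteqP; split => [x /=|x [j _] /=]; rewrite !in_itv /=.
  move=> /andP[x0 x1]; have xi0 : 0 < x^-1 by rewrite invr_gt0.
  have x2 : 2 <= x^-1 by rewrite -[leLHS]invrK lef_pV2 ?posrE ?invr_gt0 //; lra.
  have /andP[] := truncn_itv (ltW xi0); case: (Num.truncn x^-1) => [|[|j]] => n1 n2.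
  - lra.
  - lra.
  exists j => //=; rewrite in_itv /=; apply/andP; split.
    by rewrite -[ltRHS]invrK ltf_pV2 ?posrE.
  by rewrite -[leLHS]invrK lef_pV2 ?posrE.
move=> /andP[x0 x1]; apply/andP; split.
  by apply: lt_trans x0; rewrite invr_gt0.
apply: (le_trans x1); rewrite div1r lef_pV2 ?posrE // ?ler_nat //.
Qed.

Lemma trivIset_pieces :
  trivIset setT (fun j => `](j.+3%:R : R)^-1, j.+2%:R^-1]%classic).
Proof.
move=> i j _ _ [x [/=]]; rewrite !in_itv /= => /andP[i1 i2] /andP[j1 j2].
have h (k l : nat) : (k.+3%:R : R)^-1 < x -> x <= l.+2%:R^-1 -> (l <= k)%N.
  move=> kx xl; have := lt_le_trans kx xl; rewrite ltf_pV2 ?posrE // ltr_nat.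
  by rewrite ltnS !ltnS.
by apply/eqP; rewrite eqn_leq (h _ _ j1 i2) (h _ _ i1 j2).
Qed.

Lemma piece_cut j : 
  `](j.+3%:R : R)^-1, j.+2%:R^-1]%classic =
  `](j.+3%:R : R)^-1, (j.+2%:R + 1 / 2)^-1[%classic `|` `[(j.+2%:R + 1 / 2 : R)^-1, j.+2%:R^-1]%classic.
Proof.
have j2 : 0 < j.+2%:R :> R by [].
have h1 : (j.+3%:R : R)^-1 < (j.+2%:R + 1 / 2)^-1.
  by rewrite ltf_pV2 ?posrE // -?(natr1 j.+2); lra.
have h2 : (j.+2%:R + 1 / 2)^-1 <= (j.+2%:R : R)^-1.
  by rewrite lef_pV2 ?posrE //; lra.
apply/seteqP; split => x /=; rewrite !in_itv /=.
  by move=> /andP[x1 x2]; have [xl|xl] := ltP x (j.+2%:R + 1 / 2)^-1; [left|right]; rewrite ?x1 ?x2.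
by move=> [|] /andP[x1 x2]; [rewrite x1 (ltW (lt_le_trans x2 h2)) | rewrite (lt_le_trans h1 x1) x2].
Qed.

(** Countable gluing over the rank-one cylinders and the point 0, which belongs to none of them. *)
Lemma measurable_nicf_map : measurable_fun I T.
Proof.
have -> : I = [set 0] `|` \bigcup_j (@cylinder1 R (minus_digit j) `|` @cylinder1 R (plus_digit j)).
  apply/seteqP; split => [x /half_intervalP /andP[x0 x1]|x].
    have [->|xn0] := eqVneq x 0; first by left.
    have : `]0, (1 / 2 : R)]%classic x by rewrite /= in_itv /= lt_neqAle eq_sym xn0 x0.
    rewrite half_interval_pieces => -[j _]; rewrite piece_cut => xj; right; exists j => //.
    rewrite cylinder1_plus cylinder1_minus; case: xj => xj; [left|by right].
    by apply: subset_itv_oo_cc xj.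
  move=> [->|[j _ [xj|xj]]].
  - by apply/half_intervalP; lra.
  - exact: cylinder1_half (minus_digitP j) _ xj.
  - exact: cylinder1_half (plus_digitP j) _ xj.
have mm j := @measurable_cylinder1 R _ (minus_digitP j).
have mp j := @measurable_cylinder1 R _ (plus_digitP j).
apply/measurable_funU.
- exact: measurable_set1.
- by apply: bigcup_measurable => j _; exact: measurableU.
split; first exact: measurable_fun_set1.
apply/measurable_fun_bigcup => j; first exact: measurableU.
apply/measurable_funU => //; split; apply: measurable_nicf_map_cylinder1.
  exact: minus_digitP.
exact: plus_digitP.
Qed.

(** Neighbouring cylinders share end points. The sum is therefore taken over disjoint half-open
    pieces, and the missing end points are restored as null sets. *)
Lemma integral_pieces (h : R -> \bar R) : measurable_fun I h -> (forall x, I x -> (0 <= h x)%E) ->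
  (\int[mu]_(x in I) h x = \sum_(j <oo) (\int[mu]_(x in @cylinder1 R (minus_digit j)) h x +
     \int[mu]_(x in @cylinder1 R (plus_digit j)) h x))%E.
Proof.
move=> mh h0; have mI : measurable I by exact: measurable_itv.
have sub : `]0, (1 / 2 : R)]%classic `<=` I by exact: subset_itv_oc_cc.
have mh' : measurable_fun `]0, (1 / 2 : R)]%classic h by apply: measurable_funS mh.
rewrite /half_interval -integral_itv_obnd_cbnd //.
rewrite half_interval_pieces ge0_integral_bigcup //=; last first.
- exact: trivIset_pieces.
- by rewrite -half_interval_pieces => x /sub; exact: h0.
- by rewrite -half_interval_pieces.
apply: eq_eseriesr => j _.
have subj : `](j.+3%:R : R)^-1, j.+2%:R^-1]%classic `<=` I.
  by apply: subset_trans sub; rewrite half_interval_pieces => x xj; exists j.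
rewrite piece_cut in subj *; rewrite ge0_integral_setU //; last first.
- rewrite disj_set2E; apply/eqP/seteqP; split => // x [] /=; rewrite !in_itv /= => /andP[_ a] /andP[b _].
  by move: a; rewrite ltNge b.
- by move=> x /subj; exact: h0.
- by apply: measurable_funS mh.
congr (_ + _)%E; last by rewrite cylinder1_plus.
rewrite cylinder1_minus; apply/esym/integral_itv_bndoo.
by apply: measurable_funS mh => // x xj; apply: subj; left.
Qed.

End partition.

(** * Duality and cylinders *)

Section duality.
Context (R : realType).
Local Notation mu := (@lebesgue_measure R).
Local Notation I := (@half_interval R).
Local Notation dens := (@nicf_density R).
Local Notation T := (@nicf_map R).

Lemma branch_pairE j (g : R -> R) x : branch_pair j.+2%:R g x =
  digit_branch (plus_digit j).1%:~R (plus_digit j).2%:~R g x +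
  digit_branch (minus_digit j).1%:~R (minus_digit j).2%:~R g x.
Proof.
rewrite /digit_branch /= eqxx mulrNz.
have -> : (-1 == 1 :> R) = false by apply/negbTE; rewrite lt_eqF //; lra.
by rewrite /branch_pair -[j.+3%:~R]/(j.+3%:R) -(natr1 j.+2) addrK.
Qed.

Lemma measurable_half_interval : measurable I.
Proof. exact: measurable_itv. Qed.

(** Duality between [T] and the transfer operator: split over rank-one cylinders, change variables
    in each, and sum the branches back. *)
Lemma integral_nicf_map (M : R) (g : R -> R) (A : set R) : 0 <= M -> lip M g ->
  (forall u, 0 <= u <= 1 / 2 -> 0 <= g u) -> measurable A ->
  (\int[mu]_(x in I `&` T @^-1` A) (g x * dens x)%:E =
   \int[mu]_(x in I `&` A) (transfer g x * dens x)%:E)%E.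
Proof.
move=> M0 gM g0 mA.
have mI := measurable_half_interval.
have mIA : measurable (I `&` A) by exact: measurableI.
have mf := lip_dens_measurable M0 gM.
have f0 x : I x -> 0 <= g x * dens x.
  by move=> Ix; rewrite mulr_ge0 ?dens_ge0 ?g0 //; exact/half_intervalP.
set B := I `&` T @^-1` A.
have mB : measurable B by exact: measurable_nicf_map.
(* Turns the integral over [B] into one over all of [I] of a restricted function, the form that
   [integral_pieces] splits. *)
have -> : B = I `&` B by rewrite /B setIA setIid.
rewrite integral_mkcondr integral_pieces; last 2 first.
- apply/measurable_restrict => //; apply/measurable_EFinP.
  by apply: measurable_funS mf.
- by move=> x Ix; rewrite patchE; case: ifP => // _; rewrite lee_fin f0.
have termE d : nicf_digit d -> (\int[mu]_(x in @cylinder1 R d) ((fun x => (g x * dens x)%:E) \_ B) x =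
    \int[mu]_(x in I `&` A) (digit_branch d.1%:~R d.2%:~R g x * dens x)%:E)%E.
  move=> dd; rewrite -integral_mkcondr -(integral_cylinder1 dd M0) //; congr (integral _ _ _).
  by rewrite /B setIA (setIidl (cylinder1_half dd)).
have meas d : nicf_digit d ->
    measurable_fun (I `&` A) (fun x => digit_branch d.1%:~R d.2%:~R g x * dens x).
  move=> dd; have [M' M'0 gM'] := digit_branch_lip (@nicf_digit_good R d dd) M0 gM.
  by apply: measurable_funS (lip_dens_measurable M'0 gM').
have pos d x : nicf_digit d -> (I `&` A) x ->
    0 <= digit_branch d.1%:~R d.2%:~R g x * dens x.
  move=> dd [Ix _]; rewrite mulr_ge0 ?dens_ge0 //.
  by apply: (digit_branch_ge0 (@nicf_digit_good R d dd) g0); exact/half_intervalP.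
transitivity (\sum_(j <oo) \int[mu]_(x in I `&` A) (branch_pair j.+2%:R g x * dens x)%:E)%E.
  apply: eq_eseriesr => j _.
  rewrite (termE _ (plus_digitP j)) (termE _ (minus_digitP j)) -ge0_integralD //.
  - by apply: eq_integral => x _; rewrite -EFinD -mulrDl branch_pairE [in RHS]addrC.
  - by move=> x; rewrite lee_fin; apply: pos; exact: minus_digitP.
  - by apply/measurable_EFinP; apply: meas; exact: minus_digitP.
  - by move=> x; rewrite lee_fin; apply: pos; exact: plus_digitP.
  - by apply/measurable_EFinP; apply: meas; exact: plus_digitP.
have k2 j : 2 <= j.+2%:R :> R by rewrite ler_nat.
rewrite -integral_nneseries //.
- apply: eq_integral => x; rewrite inE => -[/half_intervalP xI _].
  have c : (fun n => series (fun j => branch_pair j.+2%:R g x) n * dens x) @ \oo -->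
      transfer g x * dens x.
    apply: (@cvgM _ _ \oo _ _ (cst (dens x))); last exact: cvg_cst.
    exact: is_cvg_transfer M0 gM xI.
  rewrite -(cvg_lim _ c) // -EFin_lim; last exact: cvgP c.
  congr (limn _); apply/funext => n /=.
  by rewrite /series /= mulr_suml sumEFin.
- move=> j; apply/measurable_EFinP.
  under eq_fun do rewrite branch_pairE mulrDl.
  by apply: measurable_funD; apply: meas; [exact: plus_digitP | exact: minus_digitP].
- move=> j x [Ix _]; rewrite lee_fin mulr_ge0 ?dens_ge0 ?branch_pair_ge0 //.
Qed.

Lemma nicf_preimageS n (E : set R) :
  nicf_preimage n.+1 E = I `&` T @^-1` nicf_preimage n E.
Proof.
have e x : iter n.+1 T x = iter n T (T x) by exact: iterSr.
rewrite /nicf_preimage; apply/seteqP; split => x [Ix].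
  by rewrite /mkset e => Ex; split => //; split => //; exact: nicf_map_half.
by move=> [_ Ex]; split => //; move: Ex; rewrite /mkset -e.
Qed.

Lemma measurable_nicf_preimage n (E : set R) : measurable E -> measurable (nicf_preimage n E).
Proof.
have mI := measurable_half_interval; elim: n => [|n IH] mE; first exact: measurableI.
rewrite nicf_preimageS; exact: measurable_nicf_map (IH mE).
Qed.

Lemma half_intervalI_preimage n (E : set R) : I `&` nicf_preimage n E = nicf_preimage n E.
Proof. by rewrite /nicf_preimage setIA setIid. Qed.

(** The witness is the [n]-th iterate of [transfer] on [g]; it is chosen before [E], so the later
    estimates are uniform in [E]. *)
Lemma integral_nicf_preimage (M : R) (g : R -> R) n : 0 <= M -> lip M g ->
  (forall u, 0 <= u <= 1 / 2 -> 0 <= g u) ->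
  exists g', [/\ lip ((288 / 1000) ^+ n * M) g', forall u, 0 <= u <= 1 / 2 -> 0 <= g' u &
   forall E, measurable E ->
   (\int[mu]_(x in nicf_preimage n E) (g x * dens x)%:E =
    \int[mu]_(x in I `&` E) (g' x * dens x)%:E)%E].
Proof.
elim: n M g => [|n IH] M g M0 gM g0.
  by exists g; split => //; rewrite expr0 mul1r.
have qM0 : 0 <= 288 / 1000 * M by apply: mulr_ge0; lra.
have [g' [g'M g'0 g'E]] := IH _ _ qM0 (transfer_lip M0 gM) (fun u => transfer_ge0 M0 gM g0).
exists g'; split => [||E mE]; [by rewrite exprSr -mulrA | by [] |].
rewrite nicf_preimageS (integral_nicf_map M0) //; last exact: measurable_nicf_preimage.
by rewrite half_intervalI_preimage g'E.
Qed.

Lemma cylinder_cons (d : int * int) w :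
  @cylinder R (d :: w) = I `&` (cylinder1 d `&` T @^-1` (cylinder w)).
Proof.
apply/seteqP; split => x.
  move=> xw; have [Ix xd] := xw 0%N isT; split => //; split => // i iw.
  by have := xw i.+1 iw; rewrite nicf_preimageS => -[_].
move=> [Ix [xd xw]] [|i] iw; first by split.
by rewrite nicf_preimageS; split => //; exact: (xw i iw).
Qed.

(** The empty intersection is the whole line rather than [[0, 1/2]]; it is the base case of the
    inductions on words. *)
Lemma cylinder_nil : @cylinder R [::] = setT.
Proof. by apply/seteqP; split => // x _ i. Qed.

Lemma measurable_cylinder (w : seq (int * int)) : (forall d, d \in w -> nicf_digit d) ->
  measurable (@cylinder R w).
Proof.
elim: w => [|d w IH] dw; first by rewrite cylinder_nil.
rewrite cylinder_cons setICA; apply: measurableI.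
  by apply: measurable_cylinder1; apply: dw; rewrite mem_head.
apply: measurable_nicf_map; first exact: measurable_half_interval.
by apply: IH => d' d'w; apply: dw; rewrite inE d'w orbT.
Qed.

(** Each letter of [w] restricts the transfer operator to one branch, so [g'] is a composition of
    branches. Its constant [M'] is not controlled, but depends neither on [m] nor on [E]. *)
Lemma integral_cylinder (w : seq (int * int)) (M : R) (g : R -> R) :
  (forall d, d \in w -> nicf_digit d) -> 0 <= M -> lip M g ->
  (forall u, 0 <= u <= 1 / 2 -> 0 <= g u) ->
  exists M' g', [/\ 0 <= M', lip M' g', forall u, 0 <= u <= 1 / 2 -> 0 <= g' u &
   forall m E, measurable E ->
   (\int[mu]_(x in nicf_preimage (size w + m) E `&` cylinder w) (g x * dens x)%:E =
    \int[mu]_(x in nicf_preimage m E) (g' x * dens x)%:E)%E].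
Proof.
elim: w M g => [|d w IH] M g dw M0 gM g0.
  by exists M, g; split => // m E mE; rewrite cylinder_nil setIT.
have dd : nicf_digit d by apply: dw; rewrite mem_head.
have dw' d' : d' \in w -> nicf_digit d' by move=> d'w; apply: dw; rewrite inE d'w orbT.
have gd := @nicf_digit_good R d dd.
have [M1 M10 gM1] := digit_branch_lip gd M0 gM.
have [M' [g' [M'0 g'M g'0 g'E]]] := IH _ _ dw' M10 gM1 (digit_branch_ge0 gd g0).
exists M', g'; split => // m E mE; rewrite -g'E //.
set A := nicf_preimage (size w + m) E `&` cylinder w.
have mA : measurable A.
  by apply: measurableI; [exact: measurable_nicf_preimage | exact: measurable_cylinder].
have -> : A = I `&` A by rewrite /A setIA half_intervalI_preimage.
rewrite -(integral_cylinder1 dd M0) //; congr (integral _ _ _).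
rewrite addSn nicf_preimageS cylinder_cons /A.
apply/seteqP; split => x; first by move=> [[Ix xE] [_ [xd xw]]].
move=> [xd [xE xw]]; have Ix := cylinder1_half dd xd.
by split.
Qed.

End duality.

(** * Total mass of the invariant measure *)

Section assembly.
Context (R : realType).
Local Notation mu := (@lebesgue_measure R).
Local Notation I := (@half_interval R).
Local Notation dens := (@nicf_density R).
Local Notation T := (@nicf_map R).

Lemma is_derive_ln_affine (a e x : R) : 0 < a + e * x ->
  is_derive x 1 (fun y => ln (a + e * y)) (e / (a + e * x)).
Proof.
move=> ax; have d := is_derive_affine a e x.
by rewrite mulrC; apply: (@is_derive1_comp R (@ln R) (fun y => a + e * y)); exact: is_derive1_ln.
Qed.

(** The two logarithms of the antiderivative [F] coincide at [1/2], and at 0 they differ by [ln G]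
    because [G + 1 = G ^ 2]. *)
Lemma integral_dens : (\int[mu]_(x in I) (dens x)%:E = 1%:E)%E.
Proof.
have /andP[G1 _] := golden_bounds R.
have G0 : 0 < golden R by lra.
have l0 : ln (golden R) != 0 by rewrite gt_eqF // ln_golden_gt0.
pose F (x : R) := (ln (golden R))^-1 *
  (ln (golden R + 1 * x) - ln (golden R + 1 + (-1) * x)).
have dF (x : R) : 0 <= x <= 1 / 2 -> is_derive x 1 F (dens x).
  move=> /andP[x0 x1].
  have g1 : 0 < golden R + 1 * x by lra.
  have g2 : 0 < golden R + 1 + (-1) * x by lra.
  have h := is_deriveZ (ln (golden R))^-1
    (is_deriveB (is_derive_ln_affine g1) (is_derive_ln_affine g2)).
  apply: (is_derive_eq h).
  by rewrite /nicf_density mulN1r mulNr opprK !mul1r.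
have cF (x : R) : 0 <= x <= 1 / 2 -> {for x, continuous F}.
  move=> /dF [d _]; apply: differentiable_continuous; exact/derivable1_diffP.
have oI (x : R) : x \in `]0, 1 / 2[ -> 0 <= x <= 1 / 2.
  by rewrite in_itv /= => /andP[x0 x1]; lra.
rewrite (@continuous_FTC2 _ dens F 0 (1 / 2)) //; [|exact: dens_continuous|split|].
- rewrite -EFinB /F -mulrBr (_ : golden R + 1 + -1 * (1 / 2) = golden R + 1 * (1 / 2)); last by field.
  rewrite subrr !mulr0 !addr0 sub0r opprB -golden_sq expr2 lnM ?posrE // addrK.
  by rewrite mulVf.
- by move=> x /oI /dF [].
- by apply: cvg_at_right_filter; apply: cF; lra.
- by apply: cvg_at_left_filter; apply: cF; lra.
- by move=> x /oI /dF [_ d]; rewrite derive1E.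
Qed.

End assembly.

(** * Mixing *)

Section mixing.
Context (R : realType).
Local Notation mu := (@lebesgue_measure R).
Local Notation I := (@half_interval R).
Local Notation dens := (@nicf_density R).
Local Notation T := (@nicf_map R).

Lemma nicf_measureE (A : set R) : nicf_measure A = (\int[mu]_(x in I `&` A) (dens x)%:E)%E.
Proof. by rewrite /nicf_measure setIC. Qed.

Lemma measurable_dens : measurable_fun I (EFin \o dens).
Proof.
apply/measurable_EFinP; apply: subspace_continuous_measurable_fun.
  exact: measurable_half_interval.
exact: dens_continuous.
Qed.

Lemma nicf_measure_real (A : set R) : measurable A ->
  exists2 p : R, nicf_measure A = p%:E & 0 <= p <= 1.
Proof.
move=> mA; have mI := @measurable_half_interval R.
have mIA : measurable (I `&` A) by exact: measurableI.
have d0 x : I x -> (0 <= (dens x)%:E)%E by move=> Ix; rewrite lee_fin dens_ge0.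
have p0 : (0 <= nicf_measure A)%E.
  by rewrite nicf_measureE; apply: integral_ge0 => x [Ix _]; exact: d0.
have p1 : (nicf_measure A <= 1%:E)%E.
  rewrite nicf_measureE -integral_dens; apply: ge0_subset_integral => //.
  exact: measurable_dens.
have pf : nicf_measure A \is a fin_num.
  by rewrite ge0_fin_numE //; apply: le_lt_trans p1 _; rewrite ltry.
exists (fine (nicf_measure A)); first by rewrite fineK.
by rewrite -!lee_fin fineK // p0.
Qed.

(** On [[0, 1/2]] the function [g] stays within [L / 2] of [g 0], so its integral over [E] is [g 0]
    times the measure of [E] up to that factor. *)
Lemma integral_lip_dens (L : R) (g : R -> R) (E : set R) : 0 <= L -> lip L g ->
  (forall u, 0 <= u <= 1 / 2 -> 0 <= g u) -> measurable E ->
  exists2 x : R, (\int[mu]_(x in I `&` E) (g x * dens x)%:E = x%:E)%E &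
    `|x - g 0 * fine (nicf_measure E)| <= L / 2 * fine (nicf_measure E).
Proof.
move=> L0 gL g0 mE; have mI := @measurable_half_interval R.
have mIE : measurable (I `&` E) by exact: measurableI.
have [p pE /andP[p0 p1]] := nicf_measure_real mE; rewrite pE /=.
have a0 : 0 <= g 0 by apply: g0; lra.
have dI : 0 <= L / 2 by lra.
have d0 x : (I `&` E) x -> 0 <= dens x by move=> [Ix _]; rewrite dens_ge0.
have gd0 x : (I `&` E) x -> 0 <= g x * dens x.
  by move=> [Ix Ex]; rewrite mulr_ge0 ?dens_ge0 ?g0 //; exact/half_intervalP.
have near0 x : (I `&` E) x -> `|g x - g 0| <= L / 2.
  move=> [/half_intervalP xI _]; apply: (le_trans (gL x 0 xI _)); first lra.
  by move: xI => /andP[x0 x1]; rewrite subr0 ger0_norm // ler_wpM2l //; lra.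
have md : measurable_fun (I `&` E) (EFin \o dens).
  by apply: measurable_funS measurable_dens.
have mgd : measurable_fun (I `&` E) (EFin \o (fun x => g x * dens x)).
  by apply/measurable_EFinP; apply: measurable_funS (lip_dens_measurable L0 gL).
have mcd c : measurable_fun (I `&` E) (fun x => (c%:E * (dens x)%:E)%E).
  by apply: measurable_funeM.
have int_cst c : 0 <= c -> (\int[mu]_(x in I `&` E) (c%:E * (dens x)%:E) = (c * p)%:E)%E.
  move=> c0; rewrite ge0_integralZl_EFin //.
  by rewrite -nicf_measureE pE EFinM.
have up : (\int[mu]_(x in I `&` E) (g x * dens x)%:E <= ((g 0 + L / 2) * p)%:E)%E.
  rewrite -int_cst; last lra.
  apply: ge0_le_integral => //; first exact: mcd.
  move=> x xIE; rewrite -EFinM lee_fin ler_wpM2r ?d0 //.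
  by have := near0 x xIE; rewrite ler_norml; lra.
set J := (\int[mu]_(x in I `&` E) (g x * dens x)%:E)%E in up *.
have J0 : (0 <= J)%E by apply: integral_ge0 => x /gd0; rewrite lee_fin.
have Jf : J \is a fin_num by rewrite ge0_fin_numE //; apply: le_lt_trans up _; rewrite ltry.
(* Stated as a sum because [g 0 - L / 2] may be negative, and only nonnegative integrands are
   compared. *)
have low : ((g 0 * p)%:E <= J + (L / 2 * p)%:E)%E.
  have cd0 c x : 0 <= c -> (I `&` E) x -> (0 <= c%:E * (dens x)%:E)%E.
    by move=> c0 /d0 dx; rewrite -EFinM lee_fin mulr_ge0.
  rewrite -!int_cst // /J -ge0_integralD //; [|by move=> x; exact: cd0|exact: mcd].
  apply: ge0_le_integral => //.
  - by move=> x; exact: cd0.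
  - exact: mcd.
  - exact: emeasurable_funD mgd (mcd _).
  - move=> x xIE; rewrite -!EFinM -EFinD lee_fin -mulrDl ler_wpM2r ?d0 //.
    by have := near0 x xIE; rewrite ler_norml; lra.
exists (fine J); first by rewrite fineK.
move: up low; rewrite -(fineK Jf) -EFinD !lee_fin ler_norml /= => up low.
by apply/andP; split; lra.
Qed.

End mixing.

Unset Implicit Arguments.

Theorem corollary1 (R : realType) (F : set R) (hF : is_cylinder F) :
  exists C : R, 0 < C /\
    forall (n : nat) (E : set (measurableTypeR R)),
      (1 <= n)%N -> measurable E -> E `<=` @half_interval R ->
      (`| nicf_measure (nicf_preimage n E `&` F)
          - nicf_measure E * nicf_measure F |
        <= (C * (288 / 1000) ^+ n)%:E)%E.
Proof.
case: hF => w [_ dw ->].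
have mI := @measurable_half_interval R.
have lip1 : lip 0 (cst (1 : R)) by move=> x y _ _; rewrite subrr normr0 mul0r.
have one0 (u : R) : 0 <= u <= 1 / 2 -> 0 <= cst (1 : R) u by [].
(* Starting from the density 1, [g] is what remains of the indicator of [F] after [size w] steps. *)
have [M [g [M0 gM g0 gE]]] := integral_cylinder dw (lexx 0) lip1 one0.
have mF := @measurable_cylinder R w dw.
have [y yE /andP[y0 y1]] := nicf_measure_real mF.
have : 0 < (288 / 1000 : R) < 1 by apply/andP; split; lra.
have := fun n => integral_nicf_preimage n M0 gM g0.
move: (288 / 1000 : R) => q itE /andP[q0 q1].
have qn k : 0 < q ^+ k by exact: exprn_gt0.
(* Only the [n - size w] steps after the cylinder contract, hence the division. The summand 1 serves
   [n < size w], where the trivial bound 1 on the difference suffices. *)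
exists ((M + 1) / q ^+ size w); split; first by rewrite divr_gt0 //; lra.
move=> n E _ mE EI.
have mP := measurableI _ _ (measurable_nicf_preimage n mE) mF.
have [x xE /andP[x0 x1]] := nicf_measure_real mP.
have [e eE /andP[e0 e1]] := nicf_measure_real mE.
rewrite xE eE yE -EFinM -EFinB abse_EFin lee_fin.
have [nw|nw] := ltnP n (size w).
  apply: (@le_trans _ _ 1).
    rewrite ler_norml; have := mulr_ge0 e0 y0.
    have : e * y <= 1 by rewrite mulr_ile1.
    by move=> *; apply/andP; split; lra.
  rewrite mulrAC ler_pdivlMr // mul1r.
  apply: (@le_trans _ _ (q ^+ n)).
    by apply: ler_wiXn2l; [exact: ltW|exact: ltW|exact: ltnW].
  by rewrite ler_peMl ?(ltW (qn n)) //; lra.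
rewrite -(subnKC nw) exprD mulrA divfK ?gt_eqF //.
set m := (n - size w)%N.
have [g' [g'M g'0 g'E]] := itE m.
have L0 : 0 <= q ^+ m * M by rewrite mulr_ge0 // ltW.
(* Used twice with the same [g']: [A = E] gives the correlation, and [A = [0, 1/2]] gives the
   measure of [F]. *)
have meas_eq A : measurable A ->
    nicf_measure (nicf_preimage n A `&` cylinder w) =
    (\int[lebesgue_measure]_(x in @half_interval R `&` A) (g' x * nicf_density x)%:E)%E.
  move=> mA; rewrite nicf_measureE setIA half_intervalI_preimage -g'E // -gE //.
  by rewrite subnKC //; apply: eq_integral => z _; rewrite mul1r.
have [x' x'E x'b] := integral_lip_dens L0 g'M g'0 mE.
have [z zE zb] := integral_lip_dens L0 g'M g'0 mI.
have xx' : x = x' by apply: EFin_inj; rewrite -xE meas_eq.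
have m1 : nicf_measure (@half_interval R) = 1%:E by rewrite nicf_measureE setIid integral_dens.
have yz : y = z.
  apply: EFin_inj; rewrite -yE -zE -meas_eq // nicf_measureE [RHS]nicf_measureE.
  congr (integral _ _ _); apply/seteqP; split => v; last by move=> [Iv [_ ?]].
  move=> [Iv wv]; split => //; split => //; split => //.
  by case: (n) => [//|k]; exact: nicf_map_half.
move: x'b zb; rewrite eE m1 /= !mulr1 -xx' -yz => xb yb.
(* Both [x] and [e * y] are compared with [g' 0 * e]; as [e <= 1], each error is at most
   [q ^+ m * M / 2]. *)
rewrite (_ : x - e * y = (x - g' 0 * e) - e * (y - g' 0)); last by ring.
apply: (le_trans (ler_normB _ _)); rewrite normrM (ger0_norm e0).
have b1 : q ^+ m * M / 2 * e <= q ^+ m * M / 2 by rewrite ler_piMr //; lra.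
have b2 : e * `|y - g' 0| <= q ^+ m * M / 2.
  by apply: le_trans yb; rewrite ler_piMl.
have := qn m; rewrite mulrDl mul1r (mulrC M); lra.
Qed.
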